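(* Let $b\in\{N,D\}$. Let $\mu$ be a non-atomic Borel probability measure on $[0,1]$ with $0,1\in\operatorname{supp}(\mu)$, and let $(\mu_n)_{n\in\mathbb{N}}$ be a sequence of non-atomic Borel probability measures on $[0,1]$ with $0,1\in\operatorname{supp}(\mu_n)$ and $\operatorname{supp}(\mu)\subseteq\operatorname{supp}(\mu_n)$ for all $n$, such that $\mu_n$ converges weakly to $\mu$ as $n\to\infty$. Let $f\in(C[0,1])_\mu^b$, and let $\{u(t):t\ge0\}$ be the unique solution on $(C[0,1])_\mu^b$ to $$\frac{du}{dt}(t)=\bar\Delta_\mu^b u(t),\quad t\ge 0,\qquad u(0)=f,$$ and for $n\ge1$ let $\{u_n(t):t\ge0\}$ be the unique solution on $(C[0,1])_{\mu_n}^b$ to $$\frac{du_n}{dt}(t)=\bar\Delta_{\mu_n}^b u_n(t),\quad t\ge 0,\qquad u_n(0)=\pi_n f.$$ Then $$\lim_{n\to\infty}\left\lVert\pi_n u(t)-u_n(t)\right\rVert_\infty=0,$$ uniformly for $t$ in bounded time intervals.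
   Context: For a non-atomic Borel probability measure $\nu$ on $[0,1]$ with $0,1\in\operatorname{supp}(\nu)$: Let $\mathcal{D}_\nu^2$ be the set of $f\in C^1([0,1])$ for which there is $(f')^\nu\in L^2([0,1],\nu)$ with $f'(x)=f'(0)+\int_0^x (f')^\nu\,d\nu$ for all $x\in[0,1]$. The Krein-Feller operators $\Delta_\nu^N$ (Neumann) and $\Delta_\nu^D$ (Dirichlet) on $L^2([0,1],\nu)$ are given by $f\mapsto(f')^\nu$ (computed from the representative in $\mathcal{D}_\nu^2$), with domains: $\mathcal{D}(\Delta_\nu^N)$ is the set of $f\in L^2([0,1],\nu)$ having a representative $\bar f\in\mathcal{D}_\nu^2$ with $\bar f'(0)=\bar f'(1)=0$; $\mathcal{D}(\Delta_\nu^D)$ is the set of $f\in L^2([0,1],\nu)$ having a representative $\bar f\in\mathcal{D}_\nu^2$ with $\bar f(0)=\bar f(1)=0$. $(C[0,1])_\nu^N$ is the set of elements of $L^2([0,1],\nu)$ having a continuous representative on $[0,1]$; $(C[0,1])_\nu^D$ is the set of those having a continuous representative $\bar f$ with $\bar f(0)=\bar f(1)=0$. Each is a Banach space with norm $\lVert f\rVert_\infty:=\sup_{x\in\operatorname{supp}(\nu)}|\bar f(x)|$, $\bar f$ a continuous representative; equivalently, the sup norm over $[0,1]$ of the continuous representative that is linear on every interval contained in $[0,1]\setminus\operatorname{supp}(\nu)$. For $b\in\{N,D\}$, $\bar\Delta_\nu^b$ is the part of $\Delta_\nu^b$ in $(C[0,1])_\nu^b$: $\bar\Delta_\nu^b f=\Delta_\nu^b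 f$ with $\mathcal{D}(\bar\Delta_\nu^b)=\{f\in\mathcal{D}(\Delta_\nu^b):\Delta_\nu^b f\in(C[0,1])_\nu^b\}$. Solution concept: for a Banach space $X$, an operator $A:\mathcal{D}(A)\subseteq X\to X$ and $f\in X$, a map $u:[0,\infty)\to X$ is a solution to $\frac{du}{dt}(t)=Au(t)$, $t\ge0$, $u(0)=f$, if $u(0)=f$, $u$ is continuous on $[0,\infty)$ with respect to the norm of $X$, $u(t)\in\mathcal{D}(A)$ for all $t>0$, and $\lim_{h\to0}\frac{u(t+h)-u(t)}{h}=Au(t)$ in $X$ for all $t>0$. When $\operatorname{supp}(\mu)\subseteq\operatorname{supp}(\mu_n)$, the embedding $\pi_n:(C[0,1])_\mu^b\to(C[0,1])_{\mu_n}^b$ sends $f$ to the $L^2([0,1],\mu_n)$-equivalence class of the continuous representative of $f$ that is linear on every interval contained in $[0,1]\setminus\operatorname{supp}(\mu)$. *)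

(* Defs.v *)
From HB Require Import structures.
From mathcomp Require Import all_boot all_order all_algebra.
From mathcomp Require Import all_classical all_reals all_analysis.
From mathcomp Require Import measurable_realfun.
Set Implicit Arguments.
Unset Strict Implicit.
Unset Printing Implicit Defensive.
Import Order.TTheory GRing.Theory Num.Theory.
Import numFieldNormedType.Exports.
Local Open Scope classical_set_scope.
Local Open Scope ring_scope.

(* The library provides the type [LspaceType2 mu] of classes of
   square-integrable functions modulo a.e. equality, but no vector space
   structure on it. *)
Section L2_lmodule.
Context d (T : measurableType d) (R : realType).
Variable mu : {measure set T -> \bar R}.
Local Notation L2 := (LspaceType2 mu).

HB.instance Definition _ := gen_eqMixin L2.
HB.instance Definition _ := gen_choiceMixin L2.

Lemma ae_eq_finite_norm (f g : T -> R) : measurable_fun setT f ->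
  measurable_fun setT g -> f = g %[ae mu] ->
  finite_norm mu 2%:E f -> finite_norm mu 2%:E g.
Proof.
move=> mf mg fg; rewrite /finite_norm unlock /Lnorm.
have m2 (h : T -> R) : measurable_fun setT h ->
    measurable_fun [set: T] (((fun x => x `^ 2)%E \o (fun x => `|(h x)%:E|%E)) : T -> \bar R).
  move=> mh; apply: measurableT_comp; first exact: measurable_poweR.
  by apply: measurableT_comp => //; exact/measurable_EFinP.
rewrite (@ae_eq_integral _ _ _ _ _ (fun x => (`|(EFin \o g) x| `^ 2)%E)) //; [exact: m2|exact: m2|].
by apply: filterS fg => x /= h _ /=; rewrite h.
Qed.

Lemma L2_Lfun (f : L2) : (f : T -> R) \in Lfun mu 2%:E.
Proof.
rewrite inE; apply/andP; split; rewrite inE/=.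
  have := @measurable_funPT _ _ _ _ (repr (LebesgueSpace.sort f)).
  done.
exact: (@Lebesgue_finite _ _ _ _ _ _ f).
Qed.

Lemma L2_mk_subproof (h : T -> R) : h \in Lfun mu 2%:E ->
  {f : L2 | (f : T -> R) = h %[ae mu]}.
Proof.
move=> hL; have hm : measurable_fun setT h by move: (sub_Lfun_mfun hL); rewrite inE.
have hm' : (h : T -> measurableTypeR R) \in mfun by rewrite inE.
pose H : {mfun T >-> measurableTypeR R} := mfun_Sub hm'.
pose q : {mfun_ mu, T >-> measurableTypeR R} := (\pi H)%qT.
have qh : (repr q : T -> R) = h %[ae mu].
  have /eqP := reprK q.
  by rewrite {2}/q eqmodE => /asboolP.
have qf : finite_norm mu 2%:E q.
  apply: (@ae_eq_finite_norm h) .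
  - exact: hm.
  - exact: (@measurable_funPT _ _ _ _ (repr q)).
  - by apply: filterS qh => x h' _; exact: esym (h' I).
  by move: (sub_Lfun_finLfun hL); rewrite inE.
by exists (LebesgueSpace.Pack (LebesgueSpace.Class (@isFinLebesgue.Build _ _ _ _ _ (lee1n 2) _ qf))).
Qed.

Definition L2_of (h : T -> R) (hL : h \in Lfun mu 2%:E) : L2 :=
  sval (L2_mk_subproof hL).

Lemma L2_ofE h (hL : h \in Lfun mu 2%:E) : (L2_of hL : T -> R) = h %[ae mu].
Proof. exact: (svalP (L2_mk_subproof hL)). Qed.

Lemma L2P (f g : L2) : (f : T -> R) = g %[ae mu] -> f = g.
Proof.
case: f g => [f [[pf]]] [g [[pg]]] /= fg.
have e : f = g.
  by apply/eqP; rewrite -[f]reprK -[g]reprK eqmodE; apply/asboolP.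
by subst g; rewrite (Prop_irrelevance pf pg).
Qed.

Lemma Lfun2_0 : (0 : T -> R) \in Lfun mu 2%:E.
Proof. by have [] := Lfun_submod_closed mu (lee1n 2). Qed.

Lemma Lfun2_lin a (f g : T -> R) : f \in Lfun mu 2%:E -> g \in Lfun mu 2%:E ->
  a *: f + g \in Lfun mu 2%:E.
Proof. by move=> hf hg; have [_ ->] := Lfun_submod_closed mu (lee1n 2). Qed.

Definition L2_zero : L2 := L2_of Lfun2_0.
Definition L2_lin a (f g : L2) : L2 := L2_of (Lfun2_lin a (L2_Lfun f) (L2_Lfun g)).
Definition L2_add (f g : L2) := L2_lin 1 f g.
Definition L2_scale a (f : L2) := L2_lin a f L2_zero.
Definition L2_opp (f : L2) := L2_scale (-1) f.

Lemma L2_zero_ae : (L2_zero : T -> R) = 0 %[ae mu].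
Proof. exact: L2_ofE. Qed.
Lemma L2_add_ae f g : (L2_add f g : T -> R) = (fun x => (f : T -> R) x + (g : T -> R) x) %[ae mu].
Proof. by apply: filterS (L2_ofE (Lfun2_lin 1 (L2_Lfun f) (L2_Lfun g))) => x /(_ I) /= + _ => ->; rewrite scale1r. Qed.
Lemma L2_scale_ae a f : (L2_scale a f : T -> R) = (fun x => a * (f : T -> R) x) %[ae mu].
Proof.
have := L2_ofE (Lfun2_lin a (L2_Lfun f) (L2_Lfun L2_zero)).
apply: filterS2 L2_zero_ae => x /(_ I) h0 /(_ I) h1 _.
exact: etrans h1 (etrans (congr1 (+%R (a * (f : T -> R) x)) h0) (addr0 _)).
Qed.
Lemma L2_opp_ae f : (L2_opp f : T -> R) = (fun x => - (f : T -> R) x) %[ae mu].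
Proof. by apply: filterS (L2_scale_ae (-1) f) => x /(_ I) /= + _ => ->; rewrite mulN1r. Qed.


Lemma L2_addA : associative L2_add.
Proof.
move=> f g h; apply: L2P.
apply: filterS3 (L2_add_ae f (L2_add g h)) (L2_add_ae (L2_add f g) h)
  (filterI (L2_add_ae f g) (L2_add_ae g h)).
by move=> x /(_ I) e1 /(_ I) e2 [/(_ I) e3 /(_ I) e4] _; rewrite e1 e2 e3 e4 addrA.
Qed.

Lemma L2_addC : commutative L2_add.
Proof.
move=> f g; apply: L2P.
apply: filterS2 (L2_add_ae f g) (L2_add_ae g f).
by move=> x /(_ I) e1 /(_ I) e2 _; rewrite e1 e2 addrC.
Qed.

Lemma L2_add0 : left_id L2_zero L2_add.
Proof.
move=> f; apply: L2P; apply: filterS2 (L2_add_ae L2_zero f) L2_zero_ae.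
by move=> x /(_ I) e1 /(_ I) e2 _; rewrite e1 e2 add0r.
Qed.

Lemma L2_addN : left_inverse L2_zero L2_opp L2_add.
Proof.
move=> f; apply: L2P.
apply: filterS3 (L2_add_ae (L2_opp f) f) (L2_opp_ae f) L2_zero_ae.
by move=> x /(_ I) e1 /(_ I) e2 /(_ I) e3 _; rewrite e1 e2 e3 addNr.
Qed.

HB.instance Definition _ :=
  GRing.isZmodule.Build L2 L2_addA L2_addC L2_add0 L2_addN.

Lemma L2_scaleA a b (f : L2) : L2_scale a (L2_scale b f) = L2_scale (a * b) f.
Proof.
apply: L2P; apply: filterS3 (L2_scale_ae a (L2_scale b f)) (L2_scale_ae b f)
  (L2_scale_ae (a * b) f).
by move=> x /(_ I) e1 /(_ I) e2 /(_ I) e3 _; rewrite e1 e2 e3 mulrA.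
Qed.

Lemma L2_scale1 : left_id 1 L2_scale.
Proof.
move=> f; apply: L2P; apply: filterS (L2_scale_ae 1 f).
by move=> x /(_ I) e1 _; rewrite e1 mul1r.
Qed.

Lemma L2_scaleDr : right_distributive L2_scale +%R.
Proof.
move=> a f g; apply: L2P.
apply: filterS3 (L2_scale_ae a (L2_add f g)) (L2_add_ae f g)
  (filterI (L2_add_ae (L2_scale a f) (L2_scale a g))
     (filterI (L2_scale_ae a f) (L2_scale_ae a g))).
move=> x /(_ I) e1 /(_ I) e2 [/(_ I) e3 [/(_ I) e4 /(_ I) e5]] _.
by rewrite e1 e2 mulrDr -e4 -e5 -e3.
Qed.

Lemma L2_scaleDl f : {morph L2_scale^~ f : a b / a + b}.
Proof.
move=> a b; apply: L2P.
apply: filterS3 (L2_scale_ae (a + b) f)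
  (L2_add_ae (L2_scale a f) (L2_scale b f))
  (filterI (L2_scale_ae a f) (L2_scale_ae b f)).
move=> x /(_ I) e1 /(_ I) e2 [/(_ I) e3 /(_ I) e4] _.
by rewrite e1 mulrDl -e3 -e4 -e2.
Qed.

HB.instance Definition _ := GRing.Zmodule_isLmodule.Build R L2
  L2_scaleA L2_scale1 L2_scaleDr L2_scaleDl.

Lemma L2D_ae (f g : L2) :
  (f + g : T -> R) = (fun x => (f : T -> R) x + (g : T -> R) x) %[ae mu].
Proof. exact: L2_add_ae. Qed.

Lemma L2Z_ae a (f : L2) : (a *: f : T -> R) = (fun x => a * (f : T -> R) x) %[ae mu].
Proof. exact: L2_scale_ae. Qed.

Lemma L20_ae : ((0 : L2) : T -> R) = 0 %[ae mu].
Proof. exact: L2_zero_ae. Qed.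

End L2_lmodule.

Section support.
Variable R : realType.
Implicit Type nu : {measure set (measurableTypeR R) -> \bar R}.

Definition supp nu : set R :=
  [set x | forall U : set R, open U -> U x -> (0 < nu U)%E].

Definition non_atomic nu := forall A : set (measurableTypeR R),
  measurable A -> (0 < nu A)%E ->
  exists B, [/\ measurable B, B `<=` A, (0 < nu B)%E & (nu B < nu A)%E].

End support.

(* A probability measure on [0, 1] is encoded as one on R that is concentrated
   on [0, 1]; the spaces L^2([0, 1], nu) and L^2(R, nu) then coincide. *)
Record kf_measure (R : realType) := KFMeasure {
  kf_prob :> probability (measurableTypeR R) R;
  kf_itv01 : kf_prob `[0%R, 1%R]%classic = 1%E;
  kf_non_atomic : non_atomic kf_prob;
  kf_supp0 : supp kf_prob 0;
  kf_supp1 : supp kf_prob 1 }.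

Section support_theory.
Context (R : realType) (nu : kf_measure R).

Lemma openR_measurable (U : set R) :
  open U -> measurable (U : set (measurableTypeR R)).
Proof. exact: open_measurable. Qed.

Lemma itvR_measurable (i : interval R) :
  measurable ([set` i] : set (measurableTypeR R)).
Proof. exact: measurable_itv. Qed.

Lemma kf_setC01 : nu (~` `[0%R, 1%R]%classic) = 0%E.
Proof.
have := @probability_setC _ _ _ nu _ (itvR_measurable `[0, 1]).
by rewrite kf_itv01 subee.
Qed.

Lemma supp01 : supp nu `<=` `[0, 1].
Proof.
move=> x sx; apply: contrapT => x01.
have o : open (~` `[0, 1]%classic : set R).
  by apply: closed_openC; exact: itv_closed.
have /gt_eqF/eqP[] := sx _ o x01.
exact: kf_setC01.
Qed.

Lemma supp_negligible : nu.-negligible (~` supp nu).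
Proof.
pose F n : set (measurableTypeR R) :=
  if @unpickle (rat * rat)%type n is Some (p, q) then
    if nu `]ratr p, ratr q[%classic == 0%E then `]ratr p, ratr q[%classic else set0
  else set0.
apply: (@negligibleS _ _ _ _ (\bigcup_n F n)); last first.
  apply: negligible_bigcup => n; rewrite /F.
  case: unpickle => [[p q]|]; last exact: negligible_set0.
  case: ifPn => [/eqP h|_]; last exact: negligible_set0.
  by exists `]ratr p, ratr q[%classic; split => //; exact: itvR_measurable.
move=> x /existsNP[U /not_implyP[oU /not_implyP[Ux /negP nuU]]].
have {}nuU : nu U = 0%E.
  by apply/eqP; rewrite eq_le measure_ge0 andbT leNgt.
have /nbhs_ballP[e /= e0 eU] : nbhs x U by exact: open_nbhs_nbhs.
have xe : x - e < x by rewrite ltrBlDr ltrDl.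
have ex : x < x + e by rewrite ltrDl.
have [p] := rat_in_itvoo xe; have [q] := rat_in_itvoo ex.
rewrite !in_itv /= => /andP[q1 q2] /andP[p1 p2].
have sub : `]ratr p, ratr q[%classic `<=` U.
  move=> y /=; rewrite in_itv /= => /andP[y1 y2]; apply: eU.
  rewrite /ball /= ltr_distlC; apply/andP; split; [exact: lt_trans y1|exact: lt_trans q2].
have nu0 : nu `]ratr p, ratr q[%classic = 0%E.
  apply/eqP; rewrite eq_le measure_ge0 andbT -nuU.
  by apply: le_measure; rewrite ?inE; [exact: itvR_measurable|exact: openR_measurable|].
have [n nE] : exists n, @unpickle (rat * rat)%type n = Some (p, q).
  by exists (pickle (p, q)); rewrite pickleK.
exists n; first exact: I.
by rewrite /F nE nu0 eqxx /= in_itv /= p2 q1.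
Qed.

Lemma cont_ae_supp (h k : R -> R) :
  {within `[0, 1], continuous h} -> {within `[0, 1], continuous k} ->
  h = k %[ae nu] -> {in supp nu, h =1 k}.
Proof.
move=> ch ck hk x; rewrite inE => sx; apply: contrapT => /eqP nhk.
have x01 := supp01 sx.
have c : {within `[0, 1], continuous (h - k)}.
  exact: within_continuousB.
have ne : nbhs ((h - k) x) [set r : R | r != 0].
  apply: open_nbhs_nbhs; split; first exact: open_neq.
  by rewrite /= subr_eq0.
have := c x _ ne; rewrite /= /nbhs /= -nbhs_subspace_in// => nx.
have : nbhs x [set y | `[0, 1]%classic y -> h y != k y].
  by apply: filterS nx => y hy; rewrite -subr_eq0; exact: hy.
rewrite nbhsE => -[U [oU Ux] hU].
have : nu.-negligible (U : set (measurableTypeR R)).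
  apply: (@negligibleS _ (measurableTypeR R) _ nu ((~` `[0, 1]%classic) `|` [set y | ~ (h y = k y)])).
    move=> y Uy; have [y01|ny] := pselect (`[0, 1]%classic y); [right|by left].
    exact/eqP/(hU _ Uy y01).
  apply: negligibleU.
    by exists (~` `[0, 1]%classic); split => //; [exact: (measurableC (itvR_measurable `[0, 1]))|exact: kf_setC01].
  by apply: negligibleS hk => y /= ny e; apply: ny; exact: e.
rewrite negligibleP; last exact: openR_measurable.
by move=> U0; have /gt_eqF/eqP[] := sx _ oU Ux.
Qed.

End support_theory.

Variant bcond := Neumann | Dirichlet.

Section continuous_classes.
Context (R : realType) (nu : kf_measure R).
Local Notation L2 := (LspaceType2 nu).

Definition cont_rep (f : L2) (h : R -> R) :=
  {within `[0, 1], continuous h} /\ (f : R -> R) = h %[ae nu].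

Definition bvals (b : bcond) (h : R -> R) :=
  if b is Dirichlet then h 0 = 0 /\ h 1 = 0 else True.

(* The predicate defining (C[0,1])_nu^b inside L^2([0, 1], nu). *)
Definition in_C (b : bcond) : {pred L2} :=
  fun f => `[< exists h, cont_rep f h /\ bvals b h >].

(* By [cont_rep_eq] the value does not depend on the representative chosen. *)
Definition Csup (f : L2) : R :=
  sup [set `|xget (cst 0) (cont_rep f) x| | x in supp nu].

Lemma cont_rep0 : cont_rep 0 (cst 0).
Proof. by split; [move=> x; exact: cst_continuous|exact: L20_ae]. Qed.

Lemma cont_repD f g h k :
  cont_rep f h -> cont_rep g k -> cont_rep (f + g) (h + k).
Proof.
move=> [ch fh] [ck gk]; split; first exact: within_continuousD.
apply: filterS3 (L2D_ae f g) fh gk => x /(_ I) e1 /(_ I) e2 /(_ I) e3 _.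
by rewrite e1 e2 e3.
Qed.

Lemma cont_repZ a f h : cont_rep f h -> cont_rep (a *: f) (fun x => a * h x).
Proof.
move=> [ch fh]; split.
  by move=> x; apply: cvgM; [exact: cvg_cst|exact: ch].
apply: filterS2 (L2Z_ae a f) fh => x /(_ I) e1 /(_ I) e2 _.
by rewrite e1 e2.
Qed.

Lemma in_C_submod b : submod_closed (in_C b).
Proof.
split=> [|a f g].
  by apply/asboolP; exists (cst 0); split; [exact: cont_rep0|case: b].
move=> /asboolP[h [fh bh]] /asboolP[k [gk bk]]; apply/asboolP.
exists ((fun x => a * h x) + k); split.
  exact: (cont_repD (cont_repZ a fh) gk).
case: b bh bk => //= -[h0 h1] [k0 k1].
by rewrite !fctE h0 h1 k0 k1 mulr0 addr0.
Qed.

HB.instance Definition _ b :=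
  GRing.isSubmodClosed.Build R L2 (in_C b) (in_C_submod b).

Lemma cont_rep_eq (f : L2) h k x :
  cont_rep f h -> cont_rep f k -> supp nu x -> h x = k x.
Proof.
move=> [ch eh] [ck ek] /mem_set sx; apply: (cont_ae_supp ch ck _ sx).
exact: ae_eq_trans (ae_eq_sym eh) ek.
Qed.

Lemma Csup_rep (f : L2) h : cont_rep f h -> Csup f = sup [set `|h x| | x in supp nu].
Proof.
move=> fh; rewrite /Csup; case: xgetP => [k _ fk|/(_ h)//].
by congr sup; apply/seteqP; split=> _ [x sx <-]; exists x => //;
   rewrite (cont_rep_eq fh fk sx).
Qed.

Lemma supp_sup (h : R -> R) : {within `[0, 1], continuous h} ->
  has_sup [set `|h x| | x in supp nu].
Proof.
move=> ch; split; first by exists `|h 0|, 0 => //; exact: kf_supp0.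
have cn : {within `[0, 1], continuous (fun x => `|h x|)}.
  by move=> x; apply: cvg_norm; exact: ch.
have [c _ hc] := EVT_max ler01 cn.
by exists `|h c| => _ [x sx <-]; apply: hc; exact: (supp01 sx).
Qed.

Lemma Csup_ge (f : L2) h x : cont_rep f h -> supp nu x -> `|h x| <= Csup f.
Proof.
move=> fh sx; rewrite (Csup_rep fh); apply: sup_upper_bound; last by exists x.
exact: supp_sup fh.1.
Qed.

Lemma Csup_le (f : L2) h r : cont_rep f h ->
  (forall x, supp nu x -> `|h x| <= r) -> Csup f <= r.
Proof.
move=> fh hr; rewrite (Csup_rep fh); apply: ge_sup.
  by have [] := supp_sup fh.1.
by move=> _ [x sx <-]; exact: hr.
Qed.

Record Cspace (b : bcond) := CSpace { Cval :> L2; CvalP : Cval \in in_C b }.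

HB.instance Definition _ b := [isSub for @Cval b].
HB.instance Definition _ b := [Choice of Cspace b by <:].
HB.instance Definition _ b := [SubChoice_isSubLmodule of Cspace b by <:].

Lemma Crep b (f : Cspace b) : exists h, cont_rep f h /\ bvals b h.
Proof. exact/asboolP/(CvalP f). Qed.

Lemma Csup_normD b (f g : Cspace b) :
  Csup (Cval (f + g)) <= Csup (Cval f) + Csup (Cval g).
Proof.
have [h [fh _]] := Crep f; have [k [gk _]] := Crep g.
apply: (Csup_le (cont_repD fh gk)) => x sx.
rewrite fctE; apply: (le_trans (ler_normD _ _)).
by apply: lerD; exact: Csup_ge.
Qed.

Lemma Csup_le_scale b a (f : Cspace b) :
  Csup (Cval (a *: f)) <= `|a| * Csup (Cval f).
Proof.
have [h [fh _]] := Crep f; apply: (Csup_le (cont_repZ a fh)) => x sx.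
by rewrite normrM ler_wpM2l//; exact: Csup_ge.
Qed.

Lemma Csup_normZ b a (f : Cspace b) :
  Csup (Cval (a *: f)) = `|a| * Csup (Cval f).
Proof.
apply/eqP; rewrite eq_le Csup_le_scale/=.
have [->|a0] := eqVneq a 0.
  rewrite normr0 mul0r; have [h [fh _]] := Crep (0 *: f).
  exact: le_trans (normr_ge0 _) (Csup_ge fh (kf_supp0 nu)).
rewrite mulrC -ler_pdivlMr ?normr_gt0//.
by have := Csup_le_scale a^-1 (a *: f); rewrite scalerK// normfV mulrC.
Qed.

Lemma Csup_eq0 b (f : Cspace b) : Csup (Cval f) = 0 -> f = 0.
Proof.
move=> f0; apply: val_inj; apply: L2P; have [h [fh _]] := Crep f.
have h0 : (h : measurableTypeR R -> R) = 0 %[ae nu].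
  apply: negligibleS (supp_negligible nu) => x hx sx; apply: hx => _.
  by apply/eqP; rewrite -normr_le0 -f0; exact: Csup_ge.
exact: ae_eq_trans fh.2 (ae_eq_trans h0 (ae_eq_sym (L20_ae nu))).
Qed.

HB.instance Definition _ b := @Lmodule_isNormed.Build R (Cspace b)
  (fun f => Csup (Cval f)) (@Csup_normD b) (@Csup_normZ b) (@Csup_eq0 b).

Lemma CnormE b (f : Cspace b) : `|f| = Csup (Cval f).
Proof. by []. Qed.

End continuous_classes.


Arguments Cspace {R} nu b.

Section krein_feller.
Context (R : realType) (nu : kf_measure R) (b : bcond).
Local Notation L2 := (LspaceType2 nu).

(* F' is the derivative of F on [0, 1], one-sided at the end points. *)
Definition deriv01 (F F' : R -> R) := forall x : R, x \in `[0, 1] ->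
  (F y - F x) / (y - x) @[y --> within `[0, 1] x^'] --> F' x.

(* F is in D_nu^2, with F' its derivative and g = (F')^nu. *)
Definition nu_deriv2 (F F' : R -> R) (g : L2) :=
  [/\ deriv01 F F', {within `[0, 1], continuous F'} &
      forall x : R, x \in `[0, 1] ->
        F' x = F' 0 + \int[nu]_(y in `[0, x]) g y].

Definition bcond_holds (F F' : R -> R) :=
  match b with
  | Neumann => F' 0 = 0 /\ F' 1 = 0
  | Dirichlet => F 0 = 0 /\ F 1 = 0
  end.

Definition kf_graph (f g : L2) := exists F F' : R -> R,
  [/\ (f : R -> R) = F %[ae nu], nu_deriv2 F F' g & bcond_holds F F'].

Definition kf_dom : set L2 := [set f | exists g, kf_graph f g].

(* [kf_graph] is functional: since 0 and 1 are in the support and F is affine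
   off the support, f determines F on [0, 1], hence F' and its nu-density. *)
Definition kf_op (f : L2) : L2 := xget 0 (kf_graph f).

(* The part of [kf_op] in (C[0,1])_nu^b. *)
Definition kfC_dom : set (Cspace nu b) :=
  [set f | kf_dom (Cval f) /\ kf_op (Cval f) \in in_C b].

Definition kfC_op (f : Cspace nu b) : Cspace nu b :=
  insubd (0 : Cspace nu b) (kf_op (Cval f)).

End krein_feller.

Arguments kfC_dom {R} nu b.
Arguments kfC_op {R} nu b f.

(* Solution of du/dt = A u, u(0) = f, for an operator A with domain D; the
   values u t for t < 0 are irrelevant. *)
Definition is_solution (R : realType) (X : normedModType R) (D : set X)
    (A : X -> X) (f : X) (u : R -> X) :=
  [/\ u 0 = f, {within `[0, +oo[, continuous u},
      forall t : R, 0 < t -> D (u t) &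
      forall t : R, 0 < t -> h^-1 *: (u (t + h) - u t) @[h --> 0^'] --> A (u t)].

Definition gap_affine (R : realType) (mu : kf_measure R) (h : R -> R) :=
  forall i : interval R, [set` i] `<=` `[0, 1] `\` supp mu ->
  exists c d : R, forall x : R, x \in i -> h x = c + d * x.

(* The embedding pi_n: the nu-class of the continuous representative h of f
   that is affine on the gaps of supp mu; h is unique on [0, 1]. *)
Definition embedC (R : realType) (b : bcond) (mu nu : kf_measure R)
    (f : Cspace mu b) : Cspace nu b :=
  xget 0 [set g | exists h : R -> R,
    [/\ cont_rep (Cval f) h, gap_affine mu h & (Cval g : R -> R) = h %[ae nu]]].

Arguments embedC {R b mu} nu f.

Definition weak_cvg (R : realType) (mun : nat -> kf_measure R)
    (mu : kf_measure R) :=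
  forall phi : R -> R, {within `[0, 1], continuous phi} ->
  \int[mun n]_(x in `[0, 1]) phi x @[n --> \oo]
    --> \int[mu]_(x in `[0, 1]) phi x.

(* Main.v *)
Require Import Defs.
From HB Require Import structures.
From mathcomp Require Import all_boot all_order all_algebra.
From mathcomp Require Import all_classical all_reals all_analysis.
From mathcomp Require Import measurable_realfun.
From mathcomp Require Import ring lra.
Set Implicit Arguments.
Unset Strict Implicit.
Unset Printing Implicit Defensive.
Import Order.TTheory GRing.Theory Num.Theory.
Import numFieldNormedType.Exports.
Local Open Scope classical_set_scope.
Local Open Scope ring_scope.

(** The measures enter the Krein-Feller operators only through their inverses,
which are explicit integral operators and hence depend continuously on the measure
for weak convergence. The point is that this is enough: no resolvent and no
semigroup has to be constructed, because the solutions are given.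

For one measure nu, write h-hat for the continuous representative of a class h that
is affine on the gaps of the support ([hat]). Integrating twice, the relation
g = f'' with respect to nu means that f-hat = a + c x + [primitive2] g-hat, where
[primitive2] h x is the integral of max (x - y, 0) h y ([kf_graph_kfrel]). This gives
an explicit inverse [green_op] of the operator, modulo the projection [proj_op] onto
its kernel, which is the mean under Neumann conditions and 0 under Dirichlet
conditions ([kf_pseudo_inverse]). The operator is dissipative, |y| <= |y - h y''| for
h >= 0 ([kfrel_dissipative]): if f-hat is maximal and positive at s, then s may be
taken in the support, and f'' > 0 at s would make f-hat strictly convex there, since
its second differences integrate f'' against a tent ([primitive2_convex]).
Dissipativity bounds the growth of solutions of y' = A y + r by the norm of r
([dissipative_growth]).

Now let P be the embedding, w = P u - u_n the error, G and G_n the inverses, q_n the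
projections and A_n the operators. Suppose for simplicity that u and u_n are fixed by
1 - q and 1 - q_n. Then X = P G u - G_n u_n satisfies X' = w, and Z = G_n X satisfies
Z' = A_n Z + (1 - q_n) e, where e = (G_n P - P G) u is the consistency error. By
compactness of u on [0, T], e tends to 0 uniformly ([defect_small]), because the
kernels are Lipschitz and the measures converge weakly ([green_cvg]). So Z tends to 0
uniformly by dissipativity ([green_pdiff_small]). One returns from Z to X and from X
to w by Landau's interpolation principle: a small function whose derivative is
equicontinuous has a small derivative ([loc_small_deriv]). The equicontinuity of w
reduces to that of u_n at time 0, since the difference of a solution and of its time
shift is a solution ([un_shift]), and at time 0 it follows by comparing the initial
value with a point on which the operators A_n remain bounded ([un_equicont0]). *)

(** * Calculus of functions of time with values in a normed space *)

Section vector_derivative.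
Context (R : realType).

(** y has derivative v at t, as a first order expansion. *)
Definition has_deriv (V : normedModType R) (y : R -> V) (t : R) (v : V) :=
  forall e : R, 0 < e ->
    \forall h \near (0 : R), `|y (t + h) - y t - h *: v| <= e * `|h|.

(** f is linear, with operator norm at most C. *)
Record bounded_linear (V W : normedModType R) (C : R) (f : V -> W) : Prop :=
  BoundedLinear {
    blP : linear f ;
    bl_le : forall x, `|f x| <= C * `|x| }.

Section bounded_linear_theory.
Context (V W : normedModType R) (C : R) (f : V -> W).
Hypothesis blf : bounded_linear C f.

Lemma blD x y : f (x + y) = f x + f y.
Proof. by have := blP blf 1 x y; rewrite !scale1r. Qed.

Lemma bl0 : f 0 = 0.
Proof. by apply: (addrI (f 0)); rewrite -blD !addr0. Qed.

Lemma blZ a x : f (a *: x) = a *: f x.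
Proof. by have := blP blf a x 0; rewrite bl0 !addr0. Qed.

Lemma blB x y : f (x - y) = f x - f y.
Proof. by rewrite blD -scaleN1r blZ scaleN1r. Qed.

Lemma bl_cont : continuous f.
Proof.
move=> x; apply/cvgrPdist_le => e e0.
have C1 : 0 < `|C| + 1 by rewrite ltr_wpDl.
near=> z.
rewrite -blB (le_trans (bl_le blf _))//.
have : `|x - z| <= e / (`|C| + 1).
  near: z; apply: (@cvgr_dist_le _ _ _ (nbhs x) _ id) => //.
  by rewrite divr_gt0.
rewrite ler_pdivlMr// => h; apply: le_trans h.
rewrite mulrC ler_wpM2l//.
by rewrite (le_trans (ler_norm C))// lerDl.
Unshelve. all: by end_near. Qed.

Lemma has_deriv_bl (y : R -> V) t v : has_deriv y t v -> has_deriv (f \o y) t (f v).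
Proof.
move=> yv e e0.
have C1 : 0 < `|C| + 1 by rewrite ltr_wpDl.
near=> h.
rewrite /= -blZ -!blB (le_trans (bl_le blf _))//.
have : `|y (t + h) - y t - h *: v| <= e / (`|C| + 1) * `|h|.
  by near: h; apply: yv; rewrite divr_gt0.
rewrite mulrAC ler_pdivlMr// => hh; apply: le_trans hh.
rewrite mulrC ler_wpM2l//.
by rewrite (le_trans (ler_norm C))// lerDl.
Unshelve. all: by end_near. Qed.

End bounded_linear_theory.

Lemma subrACA (V : zmodType) (a b c d : V) : a - b - (c - d) = a - c - (b - d).
Proof. by rewrite !opprD addrACA. Qed.

Lemma has_derivB (V : normedModType R) (y z : R -> V) t v w :
  has_deriv y t v -> has_deriv z t w -> has_deriv (fun s => y s - z s) t (v - w).
Proof.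
move=> yv zw e e0; have e2 : 0 < e / 2 by rewrite divr_gt0.
near=> h.
rewrite scalerBr (subrACA (y (t + h))) (subrACA (y (t + h) - y t)).
rewrite (le_trans (ler_normB _ _))//.
have -> : e * `|h| = e / 2 * `|h| + e / 2 * `|h| by rewrite -mulrDl -splitr.
by apply: lerD; near: h; [exact: yv | exact: zw].
Unshelve. all: by end_near. Qed.

Lemma has_deriv_cst (V : normedModType R) (c : V) t : has_deriv (fun=> c) t 0.
Proof.
move=> e e0; near=> h; rewrite subrr scaler0 subrr normr0.
by rewrite mulr_ge0// ltW.
Unshelve. all: by end_near. Qed.

Lemma has_deriv_shift (V : normedModType R) (y : R -> V) s t v :
  has_deriv y (s + t) v -> has_deriv (fun r => y (s + r)) t v.
Proof. by move=> yv e e0; apply: filterS (yv e e0) => h; rewrite addrA. Qed.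

Lemma has_deriv_scale (V : normedModType R) (v : V) t :
  has_deriv (fun r => r *: v) t v.
Proof.
move=> e e0; near=> h.
rewrite -!scalerBl [t + h]addrC addrK subrr scale0r normr0.
by rewrite mulr_ge0// ltW.
Unshelve. all: by end_near. Qed.

Lemma has_deriv_lim (V : normedModType R) (y : R -> V) t v :
  h^-1 *: (y (t + h) - y t) @[h --> 0^'] --> v -> has_deriv y t v.
Proof.
move=> /cvgrPdist_le yv e e0.
have := yv e e0; rewrite near_withinE => {}yv.
apply: filterS yv => h /=; have [->|h0 /(_ isT) yh] := eqVneq h 0.
  by rewrite addr0 subrr scale0r subr0 !normr0 mulr0.
have -> : y (t + h) - y t - h *: v = - h *: (v - h^-1 *: (y (t + h) - y t)).
  by rewrite scalerBr !scaleNr scalerA divff// scale1r opprK addrC.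
by rewrite normrZ normrN mulrC ler_wpM2r.
Qed.

(** A continuous function whose left difference quotients are bounded by e grows
    at rate at most e. *)
Lemma left_growth (N : R -> R) (e T : R) : continuous N -> 0 <= T ->
  (forall t eta : R, 0 < t <= T -> 0 < eta ->
     \forall h \near 0^'+, N t - N (t - h) <= h * (e + eta)) ->
  N T <= N 0 + T * e.
Proof.
move=> cN T0 hN; rewrite leNgt; apply/negP => NT.
have [T00|T00] := eqVneq T 0.
  by move: NT; rewrite T00 mul0r addr0 ltxx.
have {T0 T00} T0 : 0 < T by rewrite lt_neqAle eq_sym T00.
pose eta := (N T - (N 0 + T * e)) / (2 * T).
have eta0 : 0 < eta by rewrite divr_gt0 ?subr_gt0 ?mulr_gt0.
pose M t := N t - t * (e + eta).
have cM : continuous M.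
  move=> t; apply: cvgB; first exact: cN.
  by apply: cvgM; [exact: cvg_id|exact: cvg_cst].
have M0T : M 0 < M T.
  rewrite /M mul0r subr0 -subr_gt0.
  have -> : N T - T * (e + eta) - N 0 = (N T - (N 0 + T * e)) / 2.
    by rewrite /eta; field; rewrite gt_eqF.
  by rewrite divr_gt0// subr_gt0.
pose S := [set t : R | 0 <= t <= T /\ M T <= M t].
have ST : S T by split => //; rewrite lexx ltW.
have hS : has_inf S by split; [exists T | exists 0 => t [/andP[]]].
pose s := inf S.
have s0 : 0 <= s by apply: lb_le_inf; [exists T| move=> t [/andP[]]].
have sT : s <= T by apply: inf_lbound => //; exact: hS.2.
have Ms : M T <= M s.
  rewrite leNgt; apply/negP => MsT.
  have : \forall t \near s, M t < M T by apply: (cvgr_lt _ (cM s)).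
  move=> /nbhs_ballP[d /= d0 hd].
  have [t St ts] := inf_adherent d0 hS.
  have st : s <= t by apply: inf_lbound => //; exact: hS.2.
  have := St.2; rewrite leNgt hd// /ball /= ler0_norm ?subr_le0//.
  by rewrite opprB ltrBlDl.
have s0' : 0 < s.
  rewrite lt_neqAle s0 andbT; apply/eqP => s00.
  by move: M0T; rewrite s00 ltNge Ms.
have s0T : 0 < s <= T by rewrite s0' sT.
have hs := hN s eta s0T eta0.
near (0 : R)^'+ => h.
have h0 : 0 < h by near: h; exact: nbhs_right_gt.
have hs' : h < s by near: h; exact: nbhs_right_lt.
have : N s - N (s - h) <= h * (e + eta) by near: h.
move=> Nsh; have : S (s - h).
  split; first by rewrite subr_ge0 ltW//= lerBlDr (le_trans sT)// lerDl ltW.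
  apply: (le_trans Ms); rewrite /M; move: Nsh; lra.
move=> /(inf_lbound hS.2); rewrite -/s lerBrDr gerDl.
by rewrite leNgt h0.
Unshelve. all: by end_near. Qed.

(** Dissipativity of the operator with graph A. *)
Definition dissipative (V : normedModType R) (A : V -> V -> Prop) :=
  forall y z h, A y z -> 0 <= h -> `|y| <= `|y - h *: z|.

(** Perturbed evolution equations y' = A y + r, with r bounded by e: the norm of y
    grows at rate at most e, as y (t - h) is close to y t - h (A y t + r). *)
Lemma dissipative_growth (V : normedModType R) (A : V -> V -> Prop)
    (y : R -> V) (e T : R) :
  dissipative A -> continuous y -> 0 <= T ->
  (forall t : R, 0 < t <= T ->
     exists z r, [/\ A (y t) z, `|r| <= e & has_deriv y t (z + r)]) ->
  `|y T| <= `|y 0| + T * e.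
Proof.
move=> dA cy T0 hy; apply: (@left_growth (fun t => `|y t|)) => //.
  by move=> t; apply: cvg_norm; exact: cy.
move=> t eta tT eta0; have [z [r [Az re yt]]] := hy t tT.
move: (yt _ eta0) => /nbhs_ballP[d /= d0 hd].
near=> h.
have h0 : 0 < h by near: h; exact: nbhs_right_gt.
have hlt : h < d by near: h; exact: nbhs_right_lt.
have : `|y (t - h) - y t - (- h) *: (z + r)| <= eta * `|- h|.
  by apply: hd; rewrite /ball /= sub0r opprK gtr0_norm.
rewrite normrN (gtr0_norm h0) => hh.
rewrite lerBlDr (le_trans (dA _ _ _ Az (ltW h0)))//.
have -> : y t - h *: z = h *: r + (y (t - h) - (y (t - h) - y t - (- h) *: (z + r))).
  rewrite scaleNr scalerDr opprK -(addrA (y (t - h))) (opprD (y (t - h))).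
  rewrite (addrA (y (t - h))) subrr add0r.
  by rewrite opprD opprK (opprD (h *: z)) [RHS]addrC addrA subrK.
rewrite (le_trans (ler_normD _ _))// mulrDr -(addrA (h * e)); apply: lerD.
  by rewrite normrZ (gtr0_norm h0) ler_pM2l.
by rewrite [leRHS]addrC (le_trans (ler_normB _ _))// lerD2l mulrC.
Unshelve. all: by end_near. Qed.

Lemma mean_value_le (V : normedModType R) (y : R -> V) (z : R -> V) (e a b : R) :
  continuous y -> a <= b ->
  (forall t : R, a < t <= b -> `|z t| <= e /\ has_deriv y t (z t)) ->
  `|y b - y a| <= (b - a) * e.
Proof.
move=> cy ab hy.
pose Y t := y (a + t) - y a.
have cY : continuous Y.
  move=> t; apply: cvgB; last exact: cvg_cst.
  apply: (@continuous_comp _ _ _ (fun t => a + t) y); last exact: cy.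
  by apply: cvgD; [exact: cvg_cst|exact: cvg_id].
have := @dissipative_growth V (fun _ z => z = 0) Y e (b - a) _ cY.
rewrite /Y subrKC addr0 subrr normr0 add0r; apply.
- by move=> ? ? h -> _; rewrite scaler0 subr0.
- by rewrite subr_ge0.
move=> t tba; have abt : a < a + t <= b by rewrite ltrDl -lerBrDl.
have [h1 h2] := hy _ abt.
exists 0, (z (a + t)); split => //.
rewrite add0r -[z _]subr0; apply: has_derivB; last exact: has_deriv_cst.
exact: has_deriv_shift.
Qed.

End vector_derivative.

(** * Locally uniform smallness in varying spaces *)

Section moving_spaces.
Context (R : realType) (Y : nat -> normedModType R).

(** The functions f n tend to 0 locally uniformly on the half-line, although
    they take values in spaces which vary with n. *)
Definition loc_small (f : forall n, R -> Y n) := forall T e : R, 0 < e ->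
  \forall n \near \oo, forall t, 0 <= t <= T -> `|f n t| <= e.

(** The functions f n are equicontinuous from the right, uniformly in n large
    and locally uniformly in time. *)
Definition loc_equicont (f : forall n, R -> Y n) := forall T e : R, 0 < e ->
  exists2 tau : R, 0 < tau & \forall n \near \oo, forall s t,
    0 <= t <= T -> t <= s <= t + tau -> `|f n s - f n t| <= e.

Lemma loc_smallB f g : loc_small f -> loc_small g ->
  loc_small (fun n t => f n t - g n t).
Proof.
move=> hf hg T e e0; have e2 : 0 < e / 2 by rewrite divr_gt0.
apply: filterS2 (hf T _ e2) (hg T _ e2) => n fn gn t tT.
by rewrite (le_trans (ler_normB _ _))// (splitr e) lerD ?fn ?gn.
Qed.

Lemma loc_small_bl C (G : forall n, Y n -> Y n) f :
  (forall n, bounded_linear C (G n)) -> loc_small f ->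
  loc_small (fun n t => G n (f n t)).
Proof.
move=> bG hf T e e0.
have C1 : 0 < `|C| + 1 by rewrite ltr_wpDl.
apply: filterS (hf T _ (divr_gt0 e0 C1)) => n fn t tT.
rewrite (le_trans (bl_le (bG n) _))//.
have := fn _ tT; rewrite ler_pdivlMr// => h; apply: le_trans h.
rewrite mulrC ler_wpM2l//.
by rewrite (le_trans (ler_norm C))// lerDl.
Qed.

Lemma loc_equicontB f g : loc_equicont f -> loc_equicont g ->
  loc_equicont (fun n t => f n t - g n t).
Proof.
move=> hf hg T e e0; have e2 : 0 < e / 2 by rewrite divr_gt0.
have [t1 t10 h1] := hf T _ e2; have [t2 t20 h2] := hg T _ e2.
exists (Num.min t1 t2); first by rewrite lt_min t10.
apply: filterS2 h1 h2 => n fn gn s t tT /andP[ts].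
rewrite addr_minr le_min => /andP[s1 s2].
rewrite subrACA (le_trans (ler_normB _ _))// (splitr e).
by rewrite lerD ?fn ?gn// ts.
Qed.

Lemma loc_equicont_cst (c : forall n, Y n) : loc_equicont (fun n _ => c n).
Proof.
move=> T e e0; exists 1 => //; near=> n => s t _ _.
by rewrite subrr normr0 ltW.
Unshelve. all: by end_near. Qed.

Lemma loc_equicont_bl C (G : forall n, Y n -> Y n) f :
  (forall n, bounded_linear C (G n)) -> loc_equicont f ->
  loc_equicont (fun n t => G n (f n t)).
Proof.
move=> bG hf T e e0.
have C1 : 0 < `|C| + 1 by rewrite ltr_wpDl.
have [tau tau0 h] := hf T _ (divr_gt0 e0 C1); exists tau => //.
apply: filterS h => n fn s t tT ts.
rewrite -(blB (bG n)) (le_trans (bl_le (bG n) _))//.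
have := fn _ _ tT ts; rewrite ler_pdivlMr// => h; apply: le_trans h.
rewrite mulrC ler_wpM2l//.
by rewrite (le_trans (ler_norm C))// lerDl.
Qed.

(** Landau's interpolation principle: smallness passes from functions to their
    derivatives as soon as the latter are equicontinuous. *)
Lemma loc_small_deriv (y k : forall n, R -> Y n) :
  (forall n, continuous (y n)) ->
  (forall n t, 0 < t -> has_deriv (y n) t (k n t)) ->
  loc_small y -> loc_equicont k -> loc_small k.
Proof.
move=> cy yk hy hk T e e0; have e2 : 0 < e / 2 by rewrite divr_gt0.
have [tau tau0 h] := hk T _ e2.
have e1 : 0 < e / 4 * tau by rewrite mulr_gt0// divr_gt0.
apply: filterS2 h (hy (T + tau) _ e1) => n kn yn t /andP[t0 tT].
pose F r := y n r - r *: k n t.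
have cF : continuous F.
  move=> r; apply: cvgB; first exact: cy.
  by apply: cvgZ; [exact: cvg_id|exact: cvg_cst].
have : `|F (t + tau) - F t| <= (t + tau - t) * (e / 2).
  apply: (@mean_value_le _ _ _ (fun r => k n r - k n t)) => //.
    by rewrite lerDl ltW.
  move=> r /andP[tr rt]; split.
    by apply: kn; rewrite ?t0 ?tT// rt ltW.
  apply: has_derivB; last exact: has_deriv_scale.
  by apply: yk; exact: le_lt_trans tr.
have -> : F (t + tau) - F t = y n (t + tau) - y n t - tau *: k n t.
  by rewrite /F subrACA -scalerBl [t + tau]addrC addrK.
rewrite [t + tau]addrC addrK => Fle.
have yt : `|y n t| <= e / 4 * tau.
  by apply: yn; rewrite t0 (le_trans tT)// lerDl ltW.
have yt' : `|y n (tau + t)| <= e / 4 * tau.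
  by apply: yn; rewrite addr_ge0 ?(ltW tau0)//= [leRHS]addrC lerD2l.
have : tau * `|k n t| <= tau * e.
  rewrite -[X in X * `|_|](gtr0_norm tau0) -normrZ.
  have -> : tau *: k n t = y n (tau + t) - y n t -
      (y n (tau + t) - y n t - tau *: k n t) by rewrite opprB addrC subrK.
  rewrite (le_trans (ler_normB _ _))//.
  have -> : tau * e = e / 4 * tau + e / 4 * tau + tau * (e / 2) by field.
  by apply: lerD => //; rewrite (le_trans (ler_normB _ _))// lerD.
by rewrite ler_pM2l.
Qed.

End moving_spaces.

(** * Convergence of evolutions from convergence of the inverses *)

Lemma subr_telescope (V : zmodType) (a b c d g : V) :
  a - (g + d) = a - b - (g - (b - c)) + (c - d).
Proof.
rewrite opprB [in RHS]addrA [in RHS]addrA [a - b + _]addrA subrK [a - c - g]addrAC.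
by rewrite subrK opprD addrA.
Qed.

Section approximation.
Context (R : realType).

(** u solves u' = A u at positive times, for an operator given by its graph A. Only the
    values at nonnegative times matter; continuity on the line is a convenience. *)
Definition evolves (V : normedModType R) (A : V -> V -> Prop) (u : R -> V) :=
  continuous u /\ forall t, 0 < t -> exists2 z, A (u t) z & has_deriv u t z.

(** A dissipative operator with graph A, together with an inverse G of it modulo a
    projection q, which has its range in the kernel of the operator. *)
Record pseudo_inverse (V : normedModType R) (C : R)
    (A : V -> V -> Prop) (G q : V -> V) : Prop := PseudoInverse {
  pi_bG : bounded_linear C G;
  pi_bq : bounded_linear 1 q;
  pi_sub : forall x y x' y', A x y -> A x' y' -> A (x - x') (y - y');
  pi_dis : dissipative A;
  pi_GA : forall x y, A x y -> G y = x - q x;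
  pi_qA : forall x y, A x y -> q y = 0;
  pi_AG : forall y, A (G y) (y - q y);
  pi_qG : forall y, q (G y) = 0;
  pi_Aq : forall y, A (q y) 0 }.

Context (X : normedModType R) (Y : nat -> normedModType R) (C : R).
Context (A0 : X -> X -> Prop) (G0 q0 : X -> X).
Unset Implicit Arguments.
Context (A : forall n, Y n -> Y n -> Prop) (G q : forall n, Y n -> Y n).
Context (P : forall n, X -> Y n).
Set Implicit Arguments.
Hypothesis pi0 : pseudo_inverse C A0 G0 q0.
Hypothesis pin : forall n, pseudo_inverse C (A n) (G n) (q n).
Hypothesis bP : forall n, bounded_linear 1 (P n).
Hypothesis cvG : forall v e, 0 < e ->
  \forall n \near \oo, `|G n (P n v) - P n (G0 v)| <= e.
Hypothesis cvq : forall v e, 0 < e ->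
  \forall n \near \oo, `|P n (q0 v) - q n (P n v)| <= e.
Context (u : R -> X) (un : forall n, R -> Y n).
Hypothesis hu : evolves A0 u.
Hypothesis hun : forall n, evolves (A n) (un n).
Hypothesis un0 : forall n, un n 0 = P n (u 0).

Let cu : continuous u. Proof. exact: hu.1. Qed.
Let cun n : continuous (un n). Proof. exact: (hun n).1. Qed.
Let bG n : bounded_linear C (G n). Proof. exact: pi_bG (pin n). Qed.
Let bq n : bounded_linear 1 (q n). Proof. exact: pi_bq (pin n). Qed.
Let bG0 : bounded_linear C G0. Proof. exact: pi_bG pi0. Qed.

(* The consistency error of the inverses. *)
Let defect n (v : X) := G n (P n v) - P n (G0 v).

Lemma defectB n v w : defect n v - defect n w = defect n (v - w).
Proof. by rewrite /defect subrACA -(blB (bG n)) -!(blB (bP n)) -(blB bG0). Qed.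

Lemma Pn_le n v : `|P n v| <= `|v|.
Proof. by have := bl_le (bP n) v; rewrite mul1r. Qed.

Lemma qn_le n v : `|q n v| <= `|v|.
Proof. by have := bl_le (bq n) v; rewrite mul1r. Qed.

Lemma Gn_le n v : `|G n v| <= `|C| * `|v|.
Proof. by rewrite (le_trans (bl_le (bG n) _))// ler_wpM2r// ler_norm. Qed.

Lemma defect_le n v : `|defect n v| <= 2 * `|C| * `|v|.
Proof.
rewrite (le_trans (ler_normB _ _))// -mulrA mulr_natl mulr2n lerD//.
  by rewrite (le_trans (Gn_le _))// ler_wpM2l// Pn_le.
rewrite (le_trans (Pn_le _ _))// (le_trans (bl_le bG0 _))//.
by rewrite ler_wpM2r// ler_norm.
Qed.

(** The consistency error of G along u is small, by compactness of the
    trajectory on bounded time intervals. *)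
Lemma defect_small : loc_small (fun n t => defect n (u t)).
Proof.
move=> T e e0; have e2 : 0 < e / 2 by rewrite divr_gt0.
have cK := (compact_near_coveringP _).1 (@segment_compact R 0 T).
have C1 : 0 < 2 * `|C| + 1 by rewrite ltr_wpDl// mulr_ge0.
have h := cK nat \oo (fun n t => `|defect n (u t)| <= e) _.
have : \forall n \near \oo, `[0, T] `<=` (fun t => `|defect n (u t)| <= e).
  apply: h => t _; near=> s n => /=.
  have -> : defect n (u s) = defect n (u t) - defect n (u t - u s).
    by rewrite -defectB opprB addrC subrK.
  rewrite (le_trans (ler_normB _ _))// (splitr e) lerD//.
    by near: n; exact: cvG.
  rewrite (le_trans (defect_le _ _))//.
  have : `|u t - u s| <= e / 2 / (2 * `|C| + 1).
    near: s; apply: cvgr_dist_le; first exact: cu.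
    by rewrite divr_gt0.
  rewrite ler_pdivlMr// => hh; apply: le_trans hh.
  by rewrite mulrC ler_wpM2l// lerDl.
by apply: filterS => n hn t tT; apply: hn; rewrite /= in_itv.
Unshelve. all: by end_near. Qed.

(** The component of a solution in the kernel of the operator is conserved. *)
Lemma q0_conserved t : 0 <= t -> q0 (u t) = q0 (u 0).
Proof.
move=> t0; apply/eqP; rewrite -subr_eq0 -normr_le0.
have := @mean_value_le _ _ (q0 \o u) (fun=> 0) 0 0 t _ t0.
rewrite mulr0; apply.
  move=> s; apply: continuous_comp; first exact: cu.
  exact: (bl_cont (pi_bq pi0)).
move=> s /andP[s0 _]; rewrite normr0; split => //.
have [z Az uz] := hu.2 s s0.
rewrite -(pi_qA pi0 Az); exact: (has_deriv_bl (pi_bq pi0) uz).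
Qed.

Lemma qn_conserved n t : 0 <= t -> q n (un n t) = q n (un n 0).
Proof.
move=> t0; apply/eqP; rewrite -subr_eq0 -normr_le0.
have := @mean_value_le _ _ (q n \o un n) (fun=> 0) 0 0 t _ t0.
rewrite mulr0; apply.
  move=> s; apply: continuous_comp; first exact: cun.
  exact: (bl_cont (bq n)).
move=> s /andP[s0 _]; rewrite normr0; split => //.
have [z Az uz] := (hun n).2 s s0.
rewrite -(pi_qA (pin n) Az); exact: (has_deriv_bl (bq n) uz).
Qed.

(** Solutions depend on time with the modulus of continuity which they have at
    time 0, because the difference of a solution and its time shift is a
    solution. *)
Lemma un_shift n s t : 0 <= s -> 0 <= t ->
  `|un n (s + t) - un n t| <= `|un n s - un n 0|.
Proof.
move=> s0 t0.
have := @dissipative_growth _ _ (A n) (fun r => un n (s + r) - un n r) 0 t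
  (pi_dis (pin n)) _ t0.
rewrite mulr0 !addr0; apply.
  move=> r; apply: cvgB; last exact: cun.
  apply: (@continuous_comp _ _ _ (fun r => s + r) (un n)); last exact: cun.
  by apply: cvgD; [exact: cvg_cst|exact: cvg_id].
move=> r /andP[r0 _].
have [z Az uz] := (hun n).2 r r0.
have [z' Az' uz'] := (hun n).2 (s + r) (ltr_wpDl s0 r0).
exists (z' - z), 0; rewrite normr0 addr0; split=> //.
  exact: (pi_sub (pin n)).
by apply: has_derivB => //; exact: has_deriv_shift.
Qed.

(** At time 0 the solutions are equicontinuous: the common initial value is close
    to a point dn n of the domain, and the operators are bounded on these points. *)
Lemma un_equicont0 (e : R) : 0 < e -> exists2 tau : R, 0 < tau &
  \forall n \near \oo, forall s, 0 <= s <= tau -> `|un n s - un n 0| <= e.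
Proof.
move=> e0; have e8 : 0 < e / 8 by rewrite divr_gt0.
have : \forall s \near (0 : R), `|u 0 - u s| <= e / 8.
  by move: (@cu 0) => /cvgrPdist_le; apply.
move=> /nbhs_ballP[d /= d0 hd].
pose s0 := d / 2; have s00 : 0 < s0 by rewrite divr_gt0.
have us0 : `|u 0 - u s0| <= e / 8.
  apply: hd; rewrite /ball /= sub0r normrN gtr0_norm//.
  by rewrite ltr_pdivrMr// ltr_pMr// ltr1n.
have [k Ak _] := hu.2 s0 s00.
have k1 : 0 < 2 * `|k| + 1 by rewrite ltr_wpDl// mulr_ge0.
pose dn n := G n (P n k) + q n (P n (u s0)).
exists (e / 4 / (2 * `|k| + 1)); first by rewrite !divr_gt0.
near=> n => s /andP[s0' sle].
have dnE : `|un n 0 - dn n| <= e / 8 + e / 8 + e / 8.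
  have -> : un n 0 - dn n = P n (u 0 - u s0) - defect n k +
       (P n (q0 (u s0)) - q n (P n (u s0))).
    rewrite un0 /dn /defect (pi_GA pi0 Ak) !(blB (bP n)).
    exact: subr_telescope.
  rewrite (le_trans (ler_normD _ _))// lerD//; last by near: n; exact: cvq.
  rewrite (le_trans (ler_normB _ _))// lerD//; last by near: n; exact: cvG.
  by rewrite (le_trans (Pn_le _ _)).
have growth : `|un n s - dn n| <= `|un n 0 - dn n| + s * (2 * `|k|).
  apply: (@dissipative_growth _ _ (A n) (fun r => un n r - dn n)) => //.
  - exact: pi_dis (pin n).
  - by move=> r; apply: cvgB; [exact: cun|exact: cvg_cst].
  move=> r /andP[r0 _]; have [z Az uz] := (hun n).2 r r0.
  pose g := P n k - q n (P n k).
  exists (z - g), g; split.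
  - apply: (pi_sub (pin n)) => //.
    have := pi_sub (pin n) (pi_AG (pin n) (P n k)) (pi_Aq (pin n) (- P n (u s0))).
    rewrite subr0; congr (A n _ _); rewrite /dn; congr (_ + _).
    by rewrite -[- P n _]scaleN1r (blZ (bq n)) scaleN1r opprK.
  - rewrite /g (le_trans (ler_normB _ _))// mulr_natl mulr2n lerD//.
      exact: Pn_le.
    by rewrite (le_trans (qn_le _))// Pn_le.
  rewrite subrK -[z]subr0; apply: has_derivB => //; exact: has_deriv_cst.
have sk : s * (2 * `|k|) <= e / 4.
  move: sle; rewrite ler_pdivlMr// => sle; apply: le_trans sle.
  by rewrite ler_wpM2l// lerDl.
have -> : un n s - un n 0 = (un n s - dn n) - (un n 0 - dn n).
  by rewrite opprB addrA subrK.
rewrite (le_trans (ler_normB _ _))//.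
move: dnE growth sk; lra.
Unshelve. all: by end_near. Qed.

(* The error to be estimated, and its primitive pdiff below, up to the constant c. *)
Let w n t := P n (u t) - un n t.

Lemma u_equicont : loc_equicont (fun n t => P n (u t)).
Proof.
move=> T e e0; have e2 : 0 < e / 2 by rewrite divr_gt0.
have cK := (compact_near_coveringP _).1 (@segment_compact R 0 T).
pose Q (tau t : R) := forall s, t <= s <= t + tau -> `|u s - u t| <= e.
have h := cK R 0^'+ Q _.
have : \forall tau \near 0^'+, `[0, T] `<=` Q tau.
  apply: h => t _.
  move: (@cu t) => /cvgrPdist_le /(_ _ e2) /nbhs_ballP[d /= d0 hd].
  have d2 : 0 < d / 2 by rewrite divr_gt0.
  exists (ball t (d / 2), [set tau | 0 < tau < d / 2]).
    split; first exact: nbhsx_ballx.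
    near=> x; apply/andP; split; near: x; first exact: nbhs_right_gt.
    exact: nbhs_right_lt.
  move=> [r tau] /= [tr /andP[tau0 taud]] s /andP[rs srt].
  have -> : u s - u r = (u t - u r) - (u t - u s).
    by rewrite opprB [RHS]addrC addrA subrK.
  rewrite (le_trans (ler_normB _ _))// (splitr e) lerD//.
    by apply: hd; apply: le_ball tr; rewrite ler_pdivrMr// ler_pMr// ler1n.
  apply: hd; move: tr; rewrite /ball /= !ltr_distlC => /andP[tr1 tr2].
  by apply/andP; split; lra.
move=> near_tau.
near (0 : R)^'+ => tau.
exists tau; first by near: tau; exact: nbhs_right_gt.
have hQ : `[0, T] `<=` Q tau by near: tau.
near=> n => s t tT ts; rewrite -(blB (bP n)) (le_trans (Pn_le _ _))//.
by apply: hQ ts; rewrite /= in_itv.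
Unshelve. all: by end_near. Qed.

Lemma w_equicont : loc_equicont w.
Proof.
apply: loc_equicontB; first exact: u_equicont.
move=> T e e0; have [tau tau0 h] := un_equicont0 e0.
exists tau => //; apply: filterS h => n hn s t /andP[t0 _] /andP[ts st].
rewrite -[in un n s](subrK t s); apply: le_trans (hn (s - t) _).
  by apply: un_shift; rewrite ?subr_ge0.
by rewrite subr_ge0 ts lerBlDl.
Qed.

Let c n := P n (q0 (u 0)) - q n (P n (u 0)).

Let pdiff n t := P n (G0 (u t)) - G n (un n t).

Let w' n t := w n t - c n.

Lemma pdiff_deriv n t : 0 < t -> has_deriv (pdiff n) t (w' n t).
Proof.
move=> t0; have [z Az uz] := hu.2 t t0; have [zn Azn uzn] := (hun n).2 t t0.
have -> : w' n t = P n (G0 z) - G n zn.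
  rewrite (pi_GA pi0 Az) (pi_GA (pin n) Azn) (blB (bP n)) subrACA.
  by rewrite q0_conserved ?ltW// qn_conserved ?ltW// un0.
apply: has_derivB; last exact: (has_deriv_bl (bG n) uzn).
exact: (has_deriv_bl (bP n) (has_deriv_bl bG0 uz)).
Qed.

Lemma pdiff_cont n : continuous (pdiff n).
Proof.
move=> t; apply: cvgB; last first.
  by apply: continuous_comp; [exact: cun|exact: (bl_cont (bG n))].
apply: (@continuous_comp _ _ _ (G0 \o u) (P n)).
  by apply: continuous_comp; [exact: cu|exact: (bl_cont bG0)].
exact: (bl_cont (bP n)).
Qed.

(** The derivative of G pdiff, as the operator applied to G pdiff plus small terms;
    the component of pdiff in the kernel is itself a consistency error, because G
    takes its values in the kernel of q. *)
Lemma green_pdiff_deriv_eq n t : 0 <= t ->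
  G n (w' n t) = (pdiff n t - q n (pdiff n t)) +
    (defect n (u t) - q n (defect n (u t)) - G n (c n)).
Proof.
move=> t0; rewrite /w' /w (blB (bG n) _ (c n)) (blB (bG n) (P n (u t))).
rewrite (addrA _ _ (- G n (c n))); congr (_ - _).
have -> : G n (P n (u t)) - G n (un n t) = pdiff n t + defect n (u t).
  by rewrite [RHS]addrC /pdiff /defect subrKA.
rewrite [RHS]addrACA -opprD -(blD (bq n)).
suff -> : q n (pdiff n t + defect n (u t)) = 0 by rewrite subr0.
rewrite addrC /pdiff /defect subrKA -(blB (bG n)).
exact: pi_qG (pin n) _.
Qed.

Lemma c_small : loc_small (fun n (_ : R) => c n).
Proof. by move=> T e e0; apply: filterS (cvq (u 0) e0). Qed.

Lemma green_pdiff_small : loc_small (fun n t => G n (pdiff n t)).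
Proof.
pose r n t := defect n (u t) - q n (defect n (u t)) - G n (c n).
have rs : loc_small r.
  apply: loc_smallB; last exact: (loc_small_bl bG c_small).
  by apply: loc_smallB; [|apply: (loc_small_bl bq)]; exact: defect_small.
move=> T e e0; have e2 : 0 < e / 2 by rewrite divr_gt0.
have T1 : 0 < `|T| + 1 by rewrite ltr_wpDl.
have C1 : 0 < `|C| + 1 by rewrite ltr_wpDl.
apply: filterS2 (rs T _ (divr_gt0 e2 T1)) (defect_small 0 (divr_gt0 e2 C1)).
move=> n rn dn t /andP[t0 tT].
have : `|G n (pdiff n t)| <= `|G n (pdiff n 0)| + t * (e / 2 / (`|T| + 1)).
  apply: (@dissipative_growth _ _ (A n) (G n \o pdiff n)) => //.
  - exact: pi_dis (pin n).
  - move=> s; apply: continuous_comp; first exact: pdiff_cont.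
    exact: (bl_cont (bG n)).
  move=> s /andP[s0 st]; exists (pdiff n s - q n (pdiff n s)), (r n s); split.
  - exact: (pi_AG (pin n)).
  - by apply: rn; rewrite (ltW s0) (le_trans st).
  rewrite /r -green_pdiff_deriv_eq ?(ltW s0)//.
  exact: (has_deriv_bl (bG n) (pdiff_deriv n s0)).
move=> /le_trans; apply; rewrite [leRHS](splitr e) lerD//.
  have -> : pdiff n 0 = - defect n (u 0) by rewrite /pdiff un0 /defect opprB.
  rewrite (le_trans (Gn_le _))// normrN.
  have := dn 0; rewrite lexx => /(_ isT); rewrite ler_pdivlMr// => h.
  by apply: le_trans h; rewrite mulrC ler_wpM2l// lerDl.
rewrite mulrCA ler_piMr// ?(ltW e2)// ler_pdivrMr// mul1r.
by rewrite (le_trans tT)// (le_trans (ler_norm T))// lerDl.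
Qed.

(** Convergence of the solutions, from the convergence of the inverses alone. *)
Theorem evolution_convergence : loc_small (fun n t => P n (u t) - un n t).
Proof.
have ew' : loc_equicont w'.
  by apply: loc_equicontB; [exact: w_equicont|exact: loc_equicont_cst].
have sGw' : loc_small (fun n t => G n (w' n t)).
  apply: (@loc_small_deriv _ _ (fun n t => G n (pdiff n t))).
  - move=> n t; apply: (@continuous_comp _ _ _ (pdiff n) (G n)).
      exact: pdiff_cont.
    exact: (bl_cont (bG n)).
  - by move=> n t t0; apply: (has_deriv_bl (bG n)); exact: pdiff_deriv.
  - exact: green_pdiff_small.
  - exact: loc_equicont_bl ew'.
have sX : loc_small pdiff.
  have : loc_small (fun n t => G n (w' n t) - (defect n (u t) - G n (c n))).
    apply: loc_smallB => //; apply: loc_smallB; first exact: defect_small.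
    exact: (loc_small_bl bG c_small).
  move=> h T e e0; apply: filterS (h T e e0) => n hn t tT.
  have := hn t tT; congr (`|_| <= e).
  rewrite /w' /w (blB (bG n) _ (c n)) (blB (bG n) (P n (u t))) opprB addrA subrK /pdiff /defect opprB.
  by rewrite [LHS]addrC subrKA.
have sw' : loc_small w'.
  exact: (loc_small_deriv pdiff_cont pdiff_deriv).
move=> T e e0; have e2 : 0 < e / 2 by rewrite divr_gt0.
apply: filterS2 (sw' T _ e2) (c_small T e2) => n h1 h2 t tT.
rewrite -[X in `|X|](subrK (c n)) (le_trans (ler_normD _ _))// (splitr e).
by rewrite lerD ?h1 ?(h2 t).
Qed.

End approximation.

(** * Integration against an atomless probability measure on [0, 1] *)

Lemma lip1_cont (R : realType) (g : R -> R) :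
  (forall x y, `|g x - g y| <= `|x - y|) -> continuous g.
Proof.
move=> lg x; apply/cvgrPdist_le => e e0.
apply: filterS (nbhsx_ballx x e e0) => y /ltW.
by apply: le_trans; exact: lg.
Qed.

Lemma kernel_lip (R : realType) (a b : R) :
  `|Num.max a 0 - Num.max b 0| <= `|a - b|.
Proof.
rewrite ler_norml; case: (leP a 0) => h1; case: (leP b 0) => h2;
  have := ler_norm (a - b); have := ler_norm (- (a - b)); rewrite normrN; lra.
Qed.

Lemma kernel_cont (R : realType) (x : R) : continuous (fun y => Num.max (x - y) 0).
Proof.
apply: lip1_cont => y z; rewrite (le_trans (kernel_lip _ _))//.
have -> : x - y - (x - z) = - (y - z) by ring.
by rewrite normrN.
Qed.

Section mean_value.
Context (R : realType) (nu : kf_measure R).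

(** The mean value of h on [0, 1] with respect to nu. *)
Definition mean (h : R -> R) : R := \int[nu]_(y in `[0, 1]) h y.

(** Bounded measurable functions on [0, 1]; all the functions integrated below
    are of this kind. *)
Definition bmeas (h : R -> R) :=
  measurable_fun (setT : set (measurableTypeR R)) h /\
  exists M, forall y, 0 <= y <= 1 -> `|h y| <= M.

Lemma bmeas_cst c : bmeas (fun=> c).
Proof. by split; [exact: measurable_cst|exists `|c|]. Qed.

Lemma bmeasD g h : bmeas g -> bmeas h -> bmeas (fun y => g y + h y).
Proof.
move=> [mg [M gM]] [mh [N hN]]; split; first exact: measurable_funD.
by exists (M + N) => y y01; rewrite (le_trans (ler_normD _ _))// lerD ?gM ?hN.
Qed.

Lemma bmeasM g h : bmeas g -> bmeas h -> bmeas (fun y => g y * h y).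
Proof.
move=> [mg [M gM]] [mh [N hN]]; split; first exact: measurable_funM.
by exists (M * N) => y y01; rewrite normrM ler_pM ?gM ?hN.
Qed.

Lemma bmeasZ c h : bmeas h -> bmeas (fun y => c * h y).
Proof. by move=> bh; apply: bmeasM => //; exact: bmeas_cst. Qed.

Lemma bmeasB g h : bmeas g -> bmeas h -> bmeas (fun y => g y - h y).
Proof.
move=> bg bh; have := bmeasD bg (bmeasZ (-1) bh).
by congr bmeas; apply/funext => y; rewrite mulN1r.
Qed.

Lemma bmeas_cont h : continuous h -> bmeas h.
Proof.
move=> ch; split; first exact: continuous_measurable_fun.
have cn : {within `[0, 1], continuous (fun y => `|h y|)}.
  by apply: continuous_subspaceT => y; apply: cvg_norm; exact: ch.
have [c _ hc] := EVT_max ler01 cn.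
by exists `|h c| => y y01; apply: hc; rewrite in_itv.
Qed.

Lemma bmeas_indic (A : set R) : measurable (A : set (measurableTypeR R)) ->
  bmeas (\1_A).
Proof.
move=> mA; split; first exact: measurable_indic.
by exists 1 => y _; rewrite indicE; case: (_ \in _); rewrite ?normr1 ?normr0.
Qed.

Lemma bmeas_integrable h : bmeas h ->
  nu.-integrable (`[0, 1] : set (measurableTypeR R)) (EFin \o h).
Proof.
move=> [mh [M hM]]; apply: measurable_bounded_integrable.
- exact: itvR_measurable.
- exact: (le_lt_trans (probability_le1 nu (itvR_measurable _)) (ltry 1)).
- exact: measurable_funTS.
exists M; split; rewrite ?num_real // => N MN y y01 /=.
by rewrite (le_trans _ (ltW MN))// hM//; move: y01; rewrite /= in_itv.
Qed.

Let m01 : measurable (`[0, 1] : set (measurableTypeR R)).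
Proof. exact: itvR_measurable. Qed.

Lemma meanD g h : bmeas g -> bmeas h -> mean (fun y => g y + h y) = mean g + mean h.
Proof. by move=> bg bh; apply: RintegralD => //; exact: bmeas_integrable. Qed.

Lemma meanB g h : bmeas g -> bmeas h -> mean (fun y => g y - h y) = mean g - mean h.
Proof. by move=> bg bh; apply: RintegralB => //; exact: bmeas_integrable. Qed.

Lemma meanZ c h : bmeas h -> mean (fun y => c * h y) = c * mean h.
Proof. by move=> bh; apply: RintegralZl => //; exact: bmeas_integrable. Qed.

Lemma mean_cst c : mean (fun=> c) = c.
Proof. by rewrite /mean Rintegral_cst// (_ : fine _ = 1) ?mulr1// (_ : _ `[0, 1]%classic = 1%E)//; exact: kf_itv01. Qed.

Lemma eq_mean g h : (forall y, 0 <= y <= 1 -> g y = h y) -> mean g = mean h.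
Proof.
move=> gh; apply: eq_Rintegral => y; rewrite inE /= in_itv /=; exact: gh.
Qed.

Lemma le_mean g h : bmeas g -> bmeas h ->
  (forall y, 0 <= y <= 1 -> g y <= h y) -> mean g <= mean h.
Proof.
move=> bg bh gh.
apply: (le_Rintegral m01 (bmeas_integrable bg) (bmeas_integrable bh)).
by move=> y; rewrite /= in_itv; exact: gh.
Qed.

Lemma mean_indic (A : set R) : measurable (A : set (measurableTypeR R)) ->
  mean (\1_A) = fine (nu A).
Proof.
move=> mA; rewrite /mean /Rintegral integral_indic//; congr fine.
rewrite [RHS](measureDI _ mA m01) [X in (X + _)%E](_ : _ = 0%E) ?add0e//.
apply/eqP; rewrite eq_le measure_ge0 andbT -(kf_setC01 nu).
apply: le_measure; rewrite ?inE; [exact: measurableD|exact: measurableC|].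
exact: subDsetr.
Qed.

Lemma mean_norm_le g h : bmeas g -> bmeas h ->
  (forall y, 0 <= y <= 1 -> `|g y| <= h y) -> `|mean g| <= mean h.
Proof.
move=> bg bh gh; rewrite ler_norml; apply/andP; split.
  rewrite lerNl -mulN1r -meanZ//; apply: le_mean => //; first exact: bmeasZ.
  by move=> y /gh; rewrite ler_norml mulN1r lerNl => /andP[].
by apply: le_mean => // y /gh; rewrite ler_norml => /andP[].
Qed.

Lemma mean_bound g M : bmeas g ->
  (forall y, 0 <= y <= 1 -> `|g y| <= M) -> `|mean g| <= M.
Proof. by move=> bg gM; rewrite -[M]mean_cst; apply: mean_norm_le => //; exact: bmeas_cst. Qed.

Lemma mean_mass g (A : set R) c : bmeas g ->
  measurable (A : set (measurableTypeR R)) ->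
  (forall y, 0 <= y <= 1 -> `|g y| <= c * \1_A y) -> `|mean g| <= c * fine (nu A).
Proof.
move=> bg mA gA; rewrite -mean_indic// -meanZ; last exact: bmeas_indic.
by apply: mean_norm_le => //; apply: bmeasZ; exact: bmeas_indic.
Qed.

Lemma atomless (x : R) : nu [set x] = 0%E.
Proof.
apply/eqP; rewrite eq_le measure_ge0 andbT leNgt; apply/negP => x0.
have m1 : measurable ([set x] : set (measurableTypeR R)) by exact: measurable_set1.
have [B [mB Bx B0 Bx1]] := kf_non_atomic m1 x0.
have [Bx'|Bx'] := pselect (B x).
  have Bx2 : B = [set x] by apply/seteqP; split => // y ->.
  by move: Bx1; rewrite Bx2 ltxx.
have B00 : B = set0.
  by apply/seteqP; split => // y By; have yx := Bx _ By; apply: Bx'; rewrite -yx.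
by move: B0; rewrite B00 measure0 ltxx.
Qed.

(** Small intervals have small mass. *)
Lemma small_mass (x e : R) : 0 < e ->
  exists2 d : R, 0 < d & fine (nu `[x - d, x + d]%classic) <= e.
Proof.
move=> e0.
pose F k : set (measurableTypeR R) := `[x - k.+1%:R^-1, x + k.+1%:R^-1]%classic.
have Fx : \bigcap_k F k = [set x].
  apply/seteqP; split => [y Fy|y -> k _] /=; last first.
    by rewrite /F /= in_itv /= lerBlDr !lerDl invr_ge0 ler0n.
  apply/eqP; rewrite eq_sym -subr_eq0 -normr_le0; apply/ler_addgt0Pl => d d0.
  rewrite addr0; near \oo => k.
  have := Fy k I; rewrite /F /= in_itv /= -ler_distlC => /le_trans; apply.
  by near: k; apply: filterS (near_infty_natSinv_lt (PosNum d0)) => k /ltW.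
have mF k : measurable (F k) by exact: itvR_measurable.
have : nu (F k) @[k --> \oo] --> nu (\bigcap_k F k).
  apply: (@nonincreasing_cvg_mu _ _ _ nu F) => //.
  - exact: (le_lt_trans (probability_le1 nu (itvR_measurable _)) (ltry 1)).
  - by rewrite Fx; exact: measurable_set1.
  move=> m n mn; apply/subsetPset => y; rewrite /F /= !in_itv /=.
  rewrite -!ler_distlC => /le_trans; apply.
  by rewrite lef_pV2 ?posrE ?ltr0n// ler_nat ltnS.
rewrite Fx atomless => /fine_cvg /cvgrPdist_le /(_ _ e0) cF; near \oo => k.
exists k.+1%:R^-1; first by rewrite invr_gt0 ltr0n.
have : `|0 - fine (nu (F k))| <= e by near: k.
by rewrite sub0r normrN; apply: le_trans; exact: ler_norm.
Unshelve. all: by end_near. Qed.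


(** The double primitive of h nu, with second derivative h nu; it vanishes on the
    negative half-line, and its derivative is [primitive h]. *)
Definition primitive2 (h : R -> R) (x : R) : R :=
  mean (fun y => Num.max (x - y) 0 * h y).

(** The distribution function of h nu. *)
Definition primitive (h : R -> R) (x : R) : R :=
  mean (fun y => \1_(`]-oo, x]%classic) y * h y).

Lemma bmeas_kernel x : bmeas (fun y => Num.max (x - y) 0).
Proof.
apply: bmeas_cont; exact: kernel_cont.
Qed.

Lemma bmeas_step x : bmeas (\1_(`]-oo, x]%classic)).
Proof. by apply: bmeas_indic; exact: itvR_measurable. Qed.

Lemma primitive2D g h x : bmeas g -> bmeas h ->
  primitive2 (fun y => g y + h y) x = primitive2 g x + primitive2 h x.
Proof.
move=> bg bh; rewrite /primitive2 -meanD; try by apply: bmeasM.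
  by apply: eq_mean => y _; rewrite mulrDr.
all: by apply: bmeasM => //; exact: bmeas_kernel.
Qed.

Lemma primitive2Z c h x : bmeas h ->
  primitive2 (fun y => c * h y) x = c * primitive2 h x.
Proof.
move=> bh; rewrite /primitive2 -meanZ; first by apply: eq_mean => y _; rewrite mulrCA.
by apply: bmeasM => //; exact: bmeas_kernel.
Qed.

Lemma primitive20 h : primitive2 h 0 = 0.
Proof.
rewrite -[RHS]mean_cst; apply: eq_mean => y /andP[y0 _].
by rewrite sub0r max_r ?mul0r// lerNl oppr0.
Qed.

Lemma primitive1 h : primitive h 1 = mean h.
Proof.
apply: eq_mean => y /andP[_ y1].
by rewrite indicE mem_set ?mul1r// /= in_itv.
Qed.

Lemma eq_primitive2 g h x : (forall y, 0 <= y <= 1 -> g y = h y) ->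
  primitive2 g x = primitive2 h x.
Proof. by move=> gh; apply: eq_mean => y /gh ->. Qed.

Lemma primitive2_bound h M x : bmeas h -> 0 <= x <= 1 ->
  (forall y, 0 <= y <= 1 -> `|h y| <= M) -> `|primitive2 h x| <= M.
Proof.
move=> bh /andP[x0 x1] hM; apply: mean_bound.
  by apply: bmeasM => //; exact: bmeas_kernel.
move=> y y01; rewrite normrM; apply: le_trans (hM _ y01).
rewrite ler_piMl// ger0_norm ?le_max ?lexx ?orbT//.
by rewrite ge_max ler01 andbT; move: y01 => /andP[]; lra.
Qed.

Lemma primitive2_lip h M x z : bmeas h ->
  (forall y, 0 <= y <= 1 -> `|h y| <= M) ->
  `|primitive2 h x - primitive2 h z| <= `|x - z| * M.
Proof.
move=> bh hM; rewrite /primitive2 -meanB; try by apply: bmeasM => //; exact: bmeas_kernel.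
apply: mean_bound.
  by apply: bmeasB; apply: bmeasM => //; exact: bmeas_kernel.
move=> y y01; rewrite -mulrBl normrM ler_pM ?hM//.
rewrite (le_trans (kernel_lip _ _))//.
by have -> : x - y - (z - y) = x - z by ring.
Qed.

(** First order Taylor formula for [primitive2]: the remainder only involves the
    mass between the two points. *)
Lemma primitive2_taylor h M x z : bmeas h ->
  (forall y, 0 <= y <= 1 -> `|h y| <= M) ->
  `|primitive2 h x - primitive2 h z - (x - z) * primitive h z| <=
    `|x - z| * M * fine (nu `[Num.min x z, Num.max x z]%classic).
Proof.
move=> bh hM.
have b1 w : bmeas (fun y => Num.max (w - y) 0 * h y).
  by apply: bmeasM => //; exact: bmeas_kernel.
have b2 : bmeas (fun y => \1_(`]-oo, z]%classic) y * h y).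
  by apply: bmeasM => //; exact: bmeas_step.
have b3 := bmeasZ (x - z) b2.
rewrite /primitive2 /primitive -meanB// -meanZ// -meanB//; last exact: bmeasB.
apply: mean_mass; [by apply: bmeasB => //; exact: bmeasB|exact: itvR_measurable|].
move=> y y01; rewrite mulrA -!mulrBl normrM mulrAC.
apply: ler_pM => //; last exact: hM.
rewrite !indicE !mem_setE !in_itv /=.
have [xz|/ltW zx] := leP x z.
  rewrite (distrC x z) (@ger0_norm _ (z - x)) ?subr_ge0// ler_norml.
  case: (leP x y) => h1; case: (leP y z) => h2; case: (leP (x - y) 0) => h3;
    case: (leP (z - y) 0) => h4 /=; rewrite ?mulr1n ?mulr0n; lra.
rewrite (@ger0_norm _ (x - z)) ?subr_ge0// ler_norml.
case: (leP z y) => h1; case: (leP y x) => h2; case: (leP (x - y) 0) => h3;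
  case: (leP (z - y) 0) => h4; case: (leP y z) => h5 /=; rewrite ?mulr1n ?mulr0n; lra.
Qed.

(** The second difference of [primitive2 h] integrates h against a tent. *)
Lemma primitive2_tent h x r : bmeas h -> 0 <= r ->
  primitive2 h (x + r) + primitive2 h (x - r) - 2 * primitive2 h x =
  mean (fun y => Num.max (r - `|x - y|) 0 * h y).
Proof.
move=> bh r0.
have b1 w : bmeas (fun y => Num.max (w - y) 0 * h y).
  by apply: bmeasM => //; exact: bmeas_kernel.
rewrite /primitive2 -meanD// -meanZ// -meanB; [|exact: bmeasD|exact: bmeasZ].
apply: eq_mean => y _; rewrite mulrA -mulrDl -mulrBl; congr (_ * _).
have [xy|/ltW xy] := leP (x - y) 0; [rewrite ler0_norm//|rewrite ger0_norm//];
  case: (leP (x + r - y) 0) => h1; case: (leP (x - r - y) 0) => h2;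
  case: leP => h3; lra.
Qed.

(** Where h is positive near a point of the support, [primitive2 h] is strictly
    convex. *)
Lemma primitive2_convex h x r g : bmeas h -> supp nu x -> 0 < r -> 0 < g ->
  (forall y, 0 <= y <= 1 -> `|x - y| < r -> g <= h y) ->
  2 * primitive2 h x < primitive2 h (x + r) + primitive2 h (x - r).
Proof.
move=> bh sx r0 g0 hg; rewrite -subr_gt0 primitive2_tent ?(ltW r0)//.
pose A : set R := ball x (r / 2).
have oA : open A by exact: ball_open.
have mA : measurable (A : set (measurableTypeR R)) by exact: openR_measurable.
have r2 : 0 < r / 2 by rewrite divr_gt0.
have nA : 0 < fine (nu A).
  rewrite fine_gt0// (sx A oA); last exact: ballxx.
  exact: (le_lt_trans (probability_le1 nu mA) (ltry 1)).
have : 0 < g * (r / 2) * fine (nu A) by rewrite !mulr_gt0.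
move=> /lt_le_trans; apply; rewrite -mean_indic// -meanZ; last exact: bmeas_indic.
apply: le_mean.
- by apply: bmeasZ; exact: bmeas_indic.
- apply: bmeasM => //; apply: bmeas_cont => y.
  apply: (@continuous_comp _ _ _ (fun y => x - y) (fun z => Num.max (r - `|z|) 0)).
    by apply: cvgB; [exact: cvg_cst|exact: cvg_id].
  apply: (@continuous_comp _ _ _ (fun z : R => `|z|) (fun z => Num.max (r - z) 0)).
    exact: norm_continuous.
  exact: kernel_cont.
move=> y y01; rewrite indicE; case: (boolP (y \in A)) => [|_].
  rewrite inE /A /ball /= => yA.
  have hy : g <= h y by apply: hg => //; rewrite (lt_trans yA)// ltr_pdivrMr// ltr_pMr// ltr1n.
  rewrite mulr1 mulrC; apply: ler_pM => //; [exact: ltW|exact: ltW|].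
  by rewrite le_max; apply/orP; left; lra.
rewrite mulr0; have [yr|yr] := leP (r - `|x - y|) 0; first by rewrite mul0r.
rewrite mulr_ge0 ?(ltW yr)// (le_trans (ltW g0))// hg//; lra.
Qed.

End mean_value.

(** * Gaps of the support and interpolation *)

Section retractions.
Context (R : realType).

Lemma retract_cont (V : topologicalType) (D : set R) (r : R -> R) (h : R -> V) :
  continuous r -> (forall x, D (r x)) -> {within D, continuous h} ->
  continuous (h \o r).
Proof.
move=> cr Dr /subspace_continuousP ch x U hU.
have : \forall y \near x, D (r y) -> U (h (r y)).
  exact: (cr x _ (ch (r x) (Dr x) U hU)).
by move=> H; near_simpl; apply: filterS H => y /(_ (Dr y)).
Qed.

(** The retraction of the line onto [0, 1]; composing with it turns continuity within
    [0, 1] into continuity. *)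
Definition clamp (x : R) : R := Num.max (Num.min x 1) 0.

Lemma clamp01 x : 0 <= clamp x <= 1.
Proof. by rewrite /clamp le_max lexx orbT ge_max ler01 ge_min lexx orbT. Qed.

Lemma clampK x : 0 <= x <= 1 -> clamp x = x.
Proof. by move=> /andP[x0 x1]; rewrite /clamp min_l// max_l. Qed.

Lemma clampE x : clamp (clamp x) = clamp x.
Proof. exact/clampK/clamp01. Qed.

Lemma clamp_lip x y : `|clamp x - clamp y| <= `|x - y|.
Proof.
rewrite (le_trans (kernel_lip _ _))// ler_norml.
case: (leP x 1) => x1; case: (leP y 1) => y1;
  have := ler_norm (x - y); have := ler_norm (- (x - y)); rewrite normrN; lra.
Qed.

Lemma clamp_cont : continuous clamp.
Proof. exact/lip1_cont/clamp_lip. Qed.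

Lemma clamp_comp_cont (V : topologicalType) (h : R -> V) :
  {within `[0, 1], continuous h} -> continuous (h \o clamp).
Proof.
apply: retract_cont; first exact: clamp_cont.
by move=> x; rewrite /= in_itv /= clamp01.
Qed.

Lemma max0_comp_cont (V : topologicalType) (h : R -> V) :
  {within `[0, +oo[, continuous h} -> continuous (h \o (fun t => Num.max t 0)).
Proof.
apply: retract_cont; first by apply: lip1_cont => x y; exact: kernel_lip.
by move=> x; rewrite /= in_itv /= andbT le_max lexx orbT.
Qed.

End retractions.

Section gaps.
Context (R : realType) (nu : kf_measure R).

Lemma supp_itv s : supp nu s -> 0 <= s <= 1.
Proof. by move=> /supp01; rewrite /= in_itv. Qed.

Lemma supp_closed : closed (supp nu).
Proof.
rewrite -openC openE => x /existsNP[U /not_implyP[oU /not_implyP[Ux nU]]].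
apply: (filterS _ (open_nbhs_nbhs (conj oU Ux))) => y Uy sy.
exact/nU/sy.
Qed.

(** The end points of the gap of the support around x; both are x when x is in the
    support. *)
Definition lo x := sup [set s | supp nu s /\ s <= x].
Definition hi x := inf [set s | supp nu s /\ x <= s].

Let lo_sup x : 0 <= x -> has_sup [set s | supp nu s /\ s <= x].
Proof.
move=> x0; split; first by exists 0; split => //; exact: kf_supp0.
by exists x => s [].
Qed.

Let hi_inf x : x <= 1 -> has_inf [set s | supp nu s /\ x <= s].
Proof.
move=> x0; split; first by exists 1; split => //; exact: kf_supp1.
by exists x => s [].
Qed.

Lemma lo_le x : 0 <= x -> lo x <= x.
Proof. by move=> /lo_sup[x0 _]; apply: ge_sup => // s []. Qed.

Lemma hi_ge x : x <= 1 -> x <= hi x.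
Proof. by move=> /hi_inf[x0 _]; apply: lb_le_inf => // s []. Qed.

Lemma lo_max x s : 0 <= x -> supp nu s -> s <= x -> s <= lo x.
Proof. by move=> /lo_sup xs ss sx; apply: sup_upper_bound. Qed.

Lemma hi_min x s : x <= 1 -> supp nu s -> x <= s -> hi x <= s.
Proof. by move=> /hi_inf xs ss sx; apply: inf_lbound => //; exact: xs.2. Qed.

Lemma lo_supp x : 0 <= x -> supp nu (lo x).
Proof.
move=> x0; apply: contrapT => nl.
have : nbhs (lo x) (~` supp nu).
  by apply: open_nbhs_nbhs; split => //; exact/closed_openC/supp_closed.
move=> /nbhs_ballP[e /= e0 he].
have [s [ss sx] es] := sup_adherent e0 (lo_sup x0).
have sl := lo_max x0 ss sx.
apply: (he s) ss; rewrite /ball /= ger0_norm ?subr_ge0//.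
by move: es; rewrite -/(lo x); lra.
Qed.

Lemma hi_supp x : x <= 1 -> supp nu (hi x).
Proof.
move=> x0; apply: contrapT => nl.
have : nbhs (hi x) (~` supp nu).
  by apply: open_nbhs_nbhs; split => //; exact/closed_openC/supp_closed.
move=> /nbhs_ballP[e /= e0 he].
have [s [ss sx] es] := inf_adherent e0 (hi_inf x0).
have sl := hi_min x0 ss sx.
apply: (he s) ss; rewrite /ball /= distrC ger0_norm ?subr_ge0//.
by move: es; rewrite -/(hi x); lra.
Qed.

Lemma lo_id x : supp nu x -> lo x = x.
Proof.
move=> sx; have /andP[x0 _] := supp_itv sx.
by apply/eqP; rewrite eq_le lo_le// lo_max.
Qed.

Lemma hi_id x : supp nu x -> hi x = x.
Proof.
move=> sx; have /andP[_ x1] := supp_itv sx.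
by apply/eqP; rewrite eq_le hi_ge// hi_min.
Qed.

Lemma gap_ends x : 0 <= x <= 1 -> ~ supp nu x -> lo x < x < hi x.
Proof.
move=> /andP[x0 x1] nx; rewrite !lt_neqAle lo_le// hi_ge// !andbT.
apply/andP; split; apply/eqP => e; apply: nx; first by rewrite -e; exact: lo_supp.
by rewrite e; exact: hi_supp.
Qed.

Lemma gap_empty x s : 0 <= x <= 1 -> lo x < s < hi x -> ~ supp nu s.
Proof.
move=> /andP[x0 x1] /andP[ls sh] ss.
have [sx|/ltW sx] := leP s x.
  by move: (lo_max x0 ss sx); rewrite leNgt ls.
by move: (hi_min x1 ss sx); rewrite leNgt sh.
Qed.

(** Linear interpolation of h across the gaps of the support; on the support the
    denominator vanishes and the value is h x. *)
Definition interp (h : R -> R) x :=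
  h (lo x) + (x - lo x) / (hi x - lo x) * (h (hi x) - h (lo x)).

Lemma interp_supp h x : supp nu x -> interp h x = h x.
Proof. by move=> sx; rewrite /interp lo_id// hi_id// subrr mul0r mul0r addr0. Qed.

Lemma interp_gap h : gap_affine nu (interp h).
Proof.
move=> i isub.
have [i0|/set0P[z iz]] := eqVneq [set` i] set0.
  by exists 0, 0 => x ix; have : [set` i] x by []; rewrite i0.
pose d := (h (hi z) - h (lo z)) / (hi z - lo z).
exists (h (lo z) - lo z * d), d => x ix.
have i01 w : w \in i -> 0 <= w <= 1.
  by move=> wi; have [] := isub w wi; rewrite /= in_itv.
have iS w : w \in i -> ~ supp nu w by move=> wi; have [] := isub w wi.
have [/andP[x0 x1] /andP[z0 z1]] := (i01 _ ix, i01 _ iz).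
have between a b s : a \in i -> b \in i -> a <= s -> s <= b -> ~ supp nu s.
  move=> ia ib as_ sb; apply: iS.
  by apply: (interval_is_interval ia ib); rewrite as_.
have lz : lo x = lo z.
  congr sup; apply/seteqP; split => s [ss sx]; split => //; rewrite leNgt; apply/negP => /ltW zs.
    exact: (between z x s).
  exact: (between x z s).
have hz : hi x = hi z.
  congr inf; apply/seteqP; split => s [ss sx]; split => //; rewrite leNgt; apply/negP => /ltW zs.
    exact: (between x z s).
  exact: (between z x s).
rewrite /interp lz hz /d; ring.
Qed.

(** Near a point x of the support, an interpolated function is close to its value
    at x: in a long gap because the slope is bounded, in a short one because both
    end points are close to x. *)
Lemma interp_near_supp h x e : continuous h -> supp nu x -> 0 < e ->
  \forall y \near x, 0 <= y <= 1 -> `|interp h y - h x| <= 3 * e.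
Proof.
move=> ch sx e0.
have [M hM] : exists M, forall y, 0 <= y <= 1 -> `|h y| <= M.
  exact: (bmeas_cont ch).2.
have M0 : 0 <= M by apply: le_trans (hM 0 _) => //; rewrite lexx ler01.
have : \forall y \near x, `|h x - h y| <= e.
  by move: (ch x) => /cvgrPdist_le; apply.
move=> /nbhs_ballP[d /= d0 hd].
have M1 : 0 < 2 * M + 1 by rewrite ltr_wpDl// mulr_ge0.
have d2 : 0 < d / 2 by rewrite divr_gt0.
have d2d : d / 2 < d by rewrite ltr_pdivrMr// ltr_pMr// ltr1n.
have r1 : 0 < e * (d / 2) / (2 * M + 1) by rewrite divr_gt0// mulr_gt0.
pose r := Num.min (d / 2) (e * (d / 2) / (2 * M + 1)).
have r0 : 0 < r by rewrite lt_min d2.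
apply: filterS (nbhsx_ballx x r r0) => y; rewrite /ball /= => xy y01.
have xyd : `|x - y| < d / 2 by rewrite (lt_le_trans xy)// ge_min lexx.
have xyM : `|x - y| * (2 * M + 1) <= e * (d / 2).
  by rewrite -ler_pdivlMr// (le_trans (ltW xy))// ge_min lexx orbT.
have hdx z : `|x - z| < d -> `|h z - h x| <= e.
  by move=> xz; rewrite distrC; exact: hd.
have [sy|ny] := pselect (supp nu y).
  rewrite interp_supp// (le_trans (hdx _ (lt_trans xyd d2d)))//.
  by rewrite ler_peMl ?(ltW e0)// ler1n.
have /andP[ly hy] := gap_ends y01 ny.
have /andP[y0 y1] := y01.
have sl := lo_supp y0; have sh := hi_supp y1.
have lh0 : 0 < hi y - lo y by rewrite subr_gt0 (lt_trans ly).
pose w := h (hi y) - h (lo y).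
have w2 : `|w| <= 2 * M + 1.
  rewrite (le_trans (ler_normB _ _))// mulr_natl mulr2n -addrA.
  by rewrite lerD ?hM ?supp_itv// ler_wpDr ?hM ?supp_itv.
(* the contribution of the slope over a part t of the gap *)
have slope t : 0 <= t <= hi y - lo y ->
    (`|w| <= 2 * e) \/ (t <= `|x - y| /\ d / 2 <= hi y - lo y) ->
    `|t / (hi y - lo y) * w| <= 2 * e.
  move=> /andP[t0 tl]; rewrite normrM ger0_norm ?divr_ge0 ?(ltW lh0)//.
  move=> [we|[tx dl]].
    by rewrite (le_trans _ we)// ler_piMl// ler_pdivrMr// mul1r.
  rewrite mulrAC ler_pdivrMr// (@le_trans _ _ (e * (d / 2)))//.
    by rewrite (le_trans _ xyM)// ler_pM.
  apply: ler_pM => //; [exact: ltW|exact: ltW|].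
  by rewrite ler_peMl ?ler1n// ltW.
have tri (a b : R) : `|a| <= e -> `|b| <= 2 * e -> `|a + b| <= 3 * e.
  move=> ha hb; rewrite (le_trans (ler_normD _ _))//.
  have -> : 3 * e = e + 2 * e by ring.
  exact: lerD.
have w2e : `|x - lo y| < d -> `|x - hi y| < d -> `|w| <= 2 * e.
  move=> xl xh; have -> : w = (h (hi y) - h x) - (h (lo y) - h x) by rewrite /w; ring.
  by rewrite (le_trans (ler_normB _ _))// mulr_natl mulr2n lerD ?hdx.
have [xly|/ltW yx] := leP x y.
  have xl : x <= lo y by exact: lo_max.
  have xlx : `|x - lo y| < d.
    rewrite (lt_trans _ d2d)// (le_lt_trans _ xyd)// !ler0_norm ?subr_le0//.
    by rewrite !opprB lerD2r ltW.
  have -> : interp h y - h x =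
     (h (lo y) - h x) + (y - lo y) / (hi y - lo y) * w by rewrite /interp /w; ring.
  apply: tri; first exact: hdx.
  apply: slope; first by rewrite subr_ge0 (ltW ly) lerD2r ltW.
  have [xh|xh] := ltP `|x - hi y| d; [left; exact: w2e|right].
  rewrite distrC ger0_norm ?subr_ge0// lerD2l lerN2; split => //.
  move: xh xyd; rewrite distrC ger0_norm ?subr_ge0; last first.
    by rewrite (le_trans xly)// ltW.
  rewrite distrC ger0_norm ?subr_ge0//.
  clear - ly; lra.
have xl : hi y <= x by exact: hi_min.
have xlx : `|x - hi y| < d.
  rewrite (lt_trans _ d2d)// (le_lt_trans _ xyd)// !ger0_norm ?subr_ge0//.
  by rewrite lerD2l lerN2 ltW.
have -> : interp h y - h x =
    (h (hi y) - h x) + - ((hi y - y) / (hi y - lo y) * w).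
  by rewrite /interp /w; field; rewrite gt_eqF.
apply: tri; first exact: hdx.
rewrite normrN; apply: slope; first by rewrite subr_ge0 (ltW hy) lerD2l lerN2 ltW.
have [xh|xh] := ltP `|x - lo y| d; [left; exact: w2e|right].
rewrite ger0_norm ?subr_ge0// lerD2r; split => //.
move: xh xyd; rewrite ger0_norm ?subr_ge0; last first.
  by rewrite (le_trans _ yx)// ltW.
rewrite ger0_norm ?subr_ge0//.
clear - hy; lra.
Qed.

End gaps.

Lemma affine_cont (R : realType) (c d : R) : continuous (fun y => c + d * y).
Proof.
move=> y; apply: cvgD; first exact: cvg_cst.
by apply: cvgM; [exact: cvg_cst|exact: cvg_id].
Qed.

Section gap_affine_functions.
Context (R : realType) (nu : kf_measure R).

Lemma gap_itv (x : R) : 0 <= x <= 1 ->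
  [set` `]lo nu x, hi nu x[] `<=` `[0, 1] `\` supp nu.
Proof.
move=> x01 y /=; rewrite in_itv /= => /andP[ly yh]; split; last first.
  by apply: (gap_empty x01); rewrite ly.
have /andP[x0 x1] := x01; rewrite /= in_itv /=.
have /andP[l0 _] := supp_itv (lo_supp (nu := nu) x0).
have /andP[_ h1] := supp_itv (hi_supp (nu := nu) x1).
by rewrite (le_trans l0 (ltW ly)) (le_trans (ltW yh) h1).
Qed.

Lemma interp_cont (h : R -> R) : continuous h -> {within `[0, 1], continuous (interp nu h)}.
Proof.
move=> ch; apply/subspace_continuousP => x; rewrite /= in_itv /= => x01.
have [sx|nx] := pselect (supp nu x).
  apply/cvgrPdist_le => e e0; rewrite near_withinE.
  have e3 : 0 < e / 3 by rewrite divr_gt0.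
  apply: filterS (interp_near_supp ch sx e3) => y hy.
  rewrite /= in_itv /= => /hy hxy; rewrite /from_subspace (interp_supp h sx) distrC.
  by rewrite (le_trans hxy)// mulrCA divff// mulr1.
have [c [d cd]] := interp_gap h (gap_itv x01).
apply: cvg_within_filter.
have xi : x \in `]lo nu x, hi nu x[ by rewrite in_itv /= gap_ends.
rewrite /from_subspace cd ?in_itv//.
apply: (cvg_trans _ (@affine_cont R c d x)).
by apply: near_eq_cvg; apply: filterS (near_in_itvoo xi) => y /cd.
Qed.

(** A continuous function that is affine on the gaps of the support is bounded by its
    values on the support. *)
Lemma gap_affine_max (h : R -> R) (x : R) : {within `[0, 1], continuous h} -> gap_affine nu h ->
  0 <= x <= 1 -> exists2 s, supp nu s & h x <= h s.
Proof.
move=> ch gh x01; have [sx|nx] := pselect (supp nu x); first by exists x.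
have [c [d cd]] := gh _ (gap_itv x01).
have /andP[lx xh] := gap_ends x01 nx; have /andP[x0 x1] := x01.
have sl := lo_supp (nu := nu) x0; have sh := hi_supp (nu := nu) x1.
pose k y := h (clamp y) - (c + d * y).
have ck : continuous k.
  move=> y; apply: cvgB; first exact: (clamp_comp_cont ch).
  exact: (@affine_cont R c d y).
have k0 y : lo nu x < y < hi nu x -> k y = 0.
  move=> yi; have yi' : [set` `]lo nu x, hi nu x[] y by rewrite /= in_itv.
  have [/= + _] := gap_itv x01 yi'; rewrite in_itv /= => y01.
  rewrite /k clampK//.
  by rewrite cd ?subrr// in_itv.
have kl : k (lo nu x) = 0.
  apply/eqP; apply: contrapT => /negP; rewrite -normr_gt0 => kn.
  move: (ck (lo nu x)) => /cvgrPdist_lt /(_ _ kn) /nbhs_ballP[e /= e0 he].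
  pose y := Num.min (lo nu x + e / 2) x.
  have e2 : 0 < e / 2 by rewrite divr_gt0.
  have ly : lo nu x < y by rewrite lt_min lx ltrDl e2.
  have yx : y <= x by rewrite ge_min lexx orbT.
  have ye : y <= lo nu x + e / 2 by rewrite ge_min lexx.
  have : `|k (lo nu x) - k y| < `|k (lo nu x)|.
    apply: he; rewrite /ball /= distrC ger0_norm ?subr_ge0 ?ltW// ltrBlDl.
    rewrite (le_lt_trans ye)// ltrD2l.
    by rewrite ltr_pdivrMr// ltr_pMr// ltr1n.
  by rewrite (k0 y) ?ly ?(le_lt_trans yx)// subr0 ltxx.
have kh : k (hi nu x) = 0.
  apply/eqP; apply: contrapT => /negP; rewrite -normr_gt0 => kn.
  move: (ck (hi nu x)) => /cvgrPdist_lt /(_ _ kn) /nbhs_ballP[e /= e0 he].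
  pose y := Num.max (hi nu x - e / 2) x.
  have e2 : 0 < e / 2 by rewrite divr_gt0.
  have yh : y < hi nu x by rewrite gt_max xh ltrBlDr ltrDl e2.
  have xy : x <= y by rewrite le_max lexx orbT.
  have ye : hi nu x - e / 2 <= y by rewrite le_max lexx.
  have : `|k (hi nu x) - k y| < `|k (hi nu x)|.
    apply: he; rewrite /ball /= ger0_norm ?subr_ge0 ?ltW// ltrBlDr -ltrBlDl.
    rewrite (lt_le_trans _ ye)// ltrD2l ltrN2.
    by rewrite ltr_pdivrMr// ltr_pMr// ltr1n.
  by rewrite (k0 y) ?yh ?(lt_le_trans lx)// subr0 ltxx.
move: kl kh; rewrite /k (clampK (supp_itv sl)) (clampK (supp_itv sh)) => /eqP; rewrite subr_eq0 => /eqP hl.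
move=> /eqP; rewrite subr_eq0 => /eqP hh.
have hx : h x = c + d * x by rewrite cd// in_itv /= lx.
have [d0|/ltW d0] := leP 0 d.
  by exists (hi nu x) => //; rewrite hx hh lerD2l ler_wpM2l// ltW.
by exists (lo nu x) => //; rewrite hx hl lerD2l ler_wnM2l// ltW.
Qed.

Lemma gap_affineN (h : R -> R) : gap_affine nu h -> gap_affine nu (fun x => - h x).
Proof.
move=> gh i isub; have [c [d cd]] := gh i isub.
by exists (- c), (- d) => x /cd ->; rewrite opprD mulNr.
Qed.

Lemma gap_affineD (g h : R -> R) (a : R) : gap_affine nu g -> gap_affine nu h ->
  gap_affine nu (fun x => a * g x + h x).
Proof.
move=> gg gh i isub; have [c [d cd]] := gh i isub; have [c' [d' cd']] := gg i isub.
by exists (a * c' + c), (a * d' + d) => x xi; rewrite cd// cd'//; ring.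
Qed.

Lemma gap_affine_bound (h : R -> R) (M x : R) : {within `[0, 1], continuous h} -> gap_affine nu h ->
  (forall s, supp nu s -> `|h s| <= M) -> 0 <= x <= 1 -> `|h x| <= M.
Proof.
move=> ch gh hM x01; rewrite ler_norml; apply/andP; split; last first.
  have [s ss hs] := gap_affine_max ch gh x01.
  by rewrite (le_trans hs)// (le_trans (ler_norm _))// hM.
have ch' : {within `[0, 1], continuous (fun x => - h x)}.
  by move=> y; apply: cvgN; exact: ch.
have [s ss hs] := gap_affine_max ch' (gap_affineN gh) x01.
by rewrite lerNl (le_trans hs)// (le_trans (ler_norm _))// normrN hM.
Qed.

End gap_affine_functions.

(** * The gap-affine representative of a class *)

(** The continuous representative of f that is affine on the gaps of the support,
    extended to the line by constants. The definition is sealed, because unification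
    cannot afford to unfold it. *)
HB.lock Definition hat (R : realType) (nu : kf_measure R) (b : bcond)
    (f : Cspace nu b) : R -> R :=
  interp nu (projT1 (cid (Crep f)) \o @clamp R) \o @clamp R.

(** The element of the space with representative h (sealed as well); it is a default
    value unless h is continuous on [0, 1] with the boundary values of the space. *)
HB.lock Definition Cmk (R : realType) (nu : kf_measure R) (b : bcond)
    (h : R -> R) : Cspace nu b := xget 0 [set f | cont_rep (Cval f) h].

Section gap_affine_representative.
Context (R : realType) (nu : kf_measure R) (b : bcond).
Implicit Types f g : Cspace nu b.

Let rep f := projT1 (cid (Crep f)) \o @clamp R.

Let rep_cont f : continuous (rep f).
Proof. by rewrite /rep; case: cid => h /= [[ch _] _]; exact: clamp_comp_cont. Qed.

Lemma hat_clamp f x : hat f (clamp x) = hat f x.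
Proof. by rewrite hat.unlock /= clampE. Qed.

Lemma hat_cont f : continuous (hat f).
Proof. by rewrite hat.unlock; exact/clamp_comp_cont/interp_cont/rep_cont. Qed.

Lemma hat_within f : {within `[0, 1], continuous (hat f)}.
Proof. exact/continuous_subspaceT/hat_cont. Qed.

Lemma ae_supp (g h : R -> R) : (forall x, supp nu x -> g x = h x) ->
  (g : measurableTypeR R -> R) = h %[ae nu].
Proof.
move=> gh; apply: negligibleS (supp_negligible nu) => x /= ngh sx.
by apply: ngh => _; exact: gh.
Qed.

Lemma hat_supp f x : supp nu x -> hat f x = projT1 (cid (Crep f)) x.
Proof.
move=> sx; have x01 := supp_itv sx.
rewrite hat.unlock; change (interp nu (rep f) (clamp x) = projT1 (cid (Crep f)) x).
by rewrite (clampK x01) interp_supp// /rep /= (clampK x01).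
Qed.

Lemma hat_rep f : cont_rep (Cval f) (hat f).
Proof.
split; first exact: hat_within.
have := @hat_supp f; case: cid => h /= [[ch fh] _] hf.
by apply: ae_eq_trans fh _; apply: ae_supp => x /hf ->.
Qed.

Lemma hat_bvals f : bvals b (hat f).
Proof.
have := @hat_supp f; case: cid => h /= [_ bh] hf.
move: (hat f) hf => k hf; case: b bh => //= -[h0 h1].
by rewrite !hf//; [exact: kf_supp1|exact: kf_supp0].
Qed.

Lemma hat_gap f : gap_affine nu (hat f).
Proof.
move=> i isub; have [c [d cd]] := interp_gap (rep f) isub.
exists c, d => x xi; rewrite hat.unlock /= clampK; first exact: cd.
by have [] := isub x xi; rewrite /= in_itv.
Qed.

Lemma hat_le f x : `|hat f x| <= `|f|.
Proof.
rewrite -hat_clamp; apply: (gap_affine_bound (@hat_within f) (@hat_gap f)); last exact: clamp01.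
by move=> s ss; rewrite CnormE; apply: Csup_ge => //; exact: hat_rep.
Qed.

Lemma norm_hat_le f M : (forall x, supp nu x -> `|hat f x| <= M) -> `|f| <= M.
Proof. by move=> fM; rewrite CnormE; apply: (Csup_le (hat_rep f)). Qed.

Lemma hat_uniq f h : cont_rep (Cval f) h -> gap_affine nu h ->
  forall x, 0 <= x <= 1 -> hat f x = h x.
Proof.
move=> fh gh x x01; apply/eqP; rewrite -subr_eq0 -normr_le0.
have c : {within `[0, 1], continuous (fun y => (-1) * h y + hat f y)}.
  move=> y; apply: cvgD; last exact: hat_within.
  by apply: cvgM; [exact: cvg_cst|exact: fh.1].
have := gap_affine_bound (M := 0) c (gap_affineD (-1) gh (@hat_gap f)) _ x01.
rewrite mulN1r addrC; apply => s ss.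
by rewrite (cont_rep_eq fh (hat_rep f) ss) mulN1r addNr normr0.
Qed.

Lemma hat_eq f h : cont_rep (Cval f) h -> gap_affine nu h ->
  forall x, hat f x = h (clamp x).
Proof. by move=> fh gh x; rewrite -hat_clamp (hat_uniq fh gh)// clamp01. Qed.

Lemma hat_lin a f g x : hat (a *: f + g) x = a * hat f x + hat g x.
Proof.
pose h y := a * hat f y + hat g y.
rewrite (@hat_eq _ h); first by rewrite /h !hat_clamp.
  exact: (cont_repD (cont_repZ a (hat_rep f)) (hat_rep g)).
exact: (gap_affineD a (@hat_gap f) (@hat_gap g)).
Qed.

Lemma hat_inj f g : (forall x, supp nu x -> hat f x = hat g x) -> f = g.
Proof.
move=> fg; apply: val_inj; apply: L2P.
apply: ae_eq_trans (hat_rep f).2 _; apply: ae_eq_trans (ae_eq_sym (hat_rep g).2).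
exact: ae_supp.
Qed.

Lemma Lfun2_bounded (h : R -> R) (M : R) : continuous h -> (forall x, `|h x| <= M) ->
  (h : measurableTypeR R -> R) \in Lfun nu 2%:E.
Proof.
move=> ch hM; have mh : measurable_fun (setT : set (measurableTypeR R)) h.
  exact: continuous_measurable_fun.
have M0 : 0 <= M by apply: le_trans (hM 0).
rewrite inE; apply/andP; split; rewrite inE//=.
rewrite /finite_norm unlock; apply: poweR_lty.
have m2 : measurable_fun (setT : set (measurableTypeR R))
    (fun x => (`|(EFin \o h) x| `^ 2)%E).
  apply: (@measurableT_comp _ _ _ _ _ _ (fun x : \bar R => (x `^ 2)%E)).
    exact: measurable_poweR.
  by apply: measurableT_comp => //; exact/measurable_EFinP.
have := @integral_le_bound _ _ R nu setT _ (M `^ 2)%:E measurableT m2 _ _.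
under eq_integral => x _ do rewrite gee0_abs ?poweR_ge0//.
move=> H; apply: (le_lt_trans (H _ _)).
- by rewrite lee_fin powR_ge0.
- apply: aeW => x _; rewrite gee0_abs ?poweR_ge0//.
  rewrite (_ : `|(EFin \o h) x|%E = `|h x|%:E)// poweR_EFin lee_fin.
  by apply: ge0_ler_powR => //; rewrite ?nnegrE ?hM.
apply: (@le_lt_trans _ _ ((M `^ 2)%:E * 1)%E); last by rewrite mule1 ltry.
by apply: lee_wpmul2l; [rewrite lee_fin powR_ge0|exact: probability_le1].
Qed.

Lemma Cmk_rep (h : R -> R) : {within `[0, 1], continuous h} -> bvals b h ->
  cont_rep (Cval (Cmk nu b h)) h.
Proof.
move=> ch bh; rewrite Cmk.unlock; case: xgetP => [f _ //|noC]; exfalso.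
have hc := clamp_comp_cont ch.
have [M hM] := (bmeas_cont (hc : continuous (h \o @clamp R))).2.
have hL : ((h \o @clamp R) : measurableTypeR R -> R) \in Lfun nu 2%:E.
  apply: (@Lfun2_bounded _ M) => // x.
  by have := hM _ (clamp01 x); rewrite /= clampE.
pose f := L2_of hL.
have fh : cont_rep f h.
  split => //; apply: ae_eq_trans (L2_ofE hL) _; apply: ae_supp => x sx /=.
  by rewrite (clampK (supp_itv sx)).
have fC : f \in @in_C R nu b by apply/asboolP; exists h.
by apply: (noC (CSpace fC)).
Qed.

Lemma hat_Cmk (h : R -> R) : {within `[0, 1], continuous h} -> bvals b h ->
  gap_affine nu h -> forall x, 0 <= x <= 1 -> hat (Cmk nu b h) x = h x.
Proof. by move=> ch bh gh; apply: hat_uniq => //; exact: Cmk_rep. Qed.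

End gap_affine_representative.

(** * The integral form of the Krein-Feller operator *)

Lemma lip_cont (R : realType) (g : R -> R) M :
  (forall x y, `|g x - g y| <= `|x - y| * M) -> continuous g.
Proof.
move=> lg x; apply/cvgrPdist_le => e e0.
have M1 : 0 < `|M| + 1 by rewrite ltr_wpDl.
apply: filterS (nbhsx_ballx x (e / (`|M| + 1)) (divr_gt0 e0 M1)) => y.
rewrite /ball /= ltr_pdivlMr// => /ltW xy.
rewrite (le_trans (lg _ _))// (le_trans _ xy)// ler_wpM2l//.
by rewrite (le_trans (ler_norm M))// lerDl.
Qed.

Section primitives.
Context (R : realType) (nu : kf_measure R).

Lemma mean_lin a g h : bmeas g -> bmeas h ->
  mean nu (fun y => a * g y + h y) = a * mean nu g + mean nu h.
Proof. by move=> bg bh; rewrite meanD ?meanZ//; exact: bmeasZ. Qed.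

Lemma primitive2_lin a g h x : bmeas g -> bmeas h ->
  primitive2 nu (fun y => a * g y + h y) x = a * primitive2 nu g x + primitive2 nu h x.
Proof. by move=> bg bh; rewrite primitive2D ?primitive2Z//; exact: bmeasZ. Qed.

Lemma primitive2_cont h : bmeas h -> continuous (primitive2 nu h).
Proof.
move=> bh; have [M hM] := bh.2.
by apply: (@lip_cont _ _ M) => x y; exact: primitive2_lip.
Qed.

Lemma supp_mass0 (A : set R) : measurable (A : set (measurableTypeR R)) ->
  A `<=` ~` supp nu -> nu A = 0%E.
Proof.
by move=> mA As; apply: measure_negligible => //; apply: negligibleS (supp_negligible nu).
Qed.

(** Off the support the remainder in [primitive2_taylor] vanishes. *)
Lemma primitive2_gap h : bmeas h -> gap_affine nu (primitive2 nu h).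
Proof.
move=> bh i isub; have [M hM] := bh.2.
have [i0|/set0P[z iz]] := eqVneq [set` i] set0.
  by exists 0, 0 => x ix; have : [set` i] x by []; rewrite i0.
exists (primitive2 nu h z - z * primitive nu h z), (primitive nu h z) => x xi.
have := primitive2_taylor nu x z bh hM.
rewrite supp_mass0; last 2 first.
- exact: itvR_measurable.
- move=> y; rewrite /= in_itv /= => /andP[y1 y2].
  have [] : (`[0, 1] `\` supp nu) y => //; apply: isub.
  have [xz|/ltW zx] := leP x z.
    by apply: (interval_is_interval xi iz); move: y1 y2; rewrite min_l// max_r// => -> ->.
  by apply: (interval_is_interval iz xi); move: y1 y2; rewrite min_r// max_l// => -> ->.
rewrite mulr0 normr_le0 subr_eq0 => /eqP e.
by apply: (addIr (- primitive2 nu h z)); rewrite e; ring.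
Qed.

Lemma primitive2_le0 h x : x <= 0 -> primitive2 nu h x = 0.
Proof.
move=> x0; rewrite -[RHS](mean_cst nu); apply: eq_mean => y /andP[y0 _].
by rewrite max_r ?mul0r// subr_le0 (le_trans x0).
Qed.

Lemma primitive2_ge1 h x : bmeas h -> 1 <= x ->
  primitive2 nu h x = primitive2 nu h 1 + (x - 1) * mean nu h.
Proof.
move=> bh x1; rewrite /primitive2 -meanZ// -meanD; last exact: bmeasZ.
  apply: eq_mean => y /andP[_ y1].
  by rewrite !max_l ?subr_ge0 ?(le_trans y1)//; ring.
by apply: bmeasM => //; exact: bmeas_kernel.
Qed.

End primitives.

Section deriv01_theory.
Context (R : realType).


(** First order expansion form of [deriv01]. *)
Lemma deriv01_eps (F F' : R -> R) (x e : R) : deriv01 F F' -> 0 <= x <= 1 -> 0 < e ->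
  exists2 d, 0 < d & forall y, 0 <= y <= 1 -> `|x - y| < d ->
    `|F y - F x - F' x * (y - x)| <= e * `|y - x|.
Proof.
move=> dF x01 e0; have xi : x \in `[0, 1] by rewrite in_itv.
have := dF x xi => /cvgrPdist_le /(_ e e0).
rewrite near_withinE => /nbhs_ballP[d /= d0 hd].
exists d => // y y01 xy; have [->|yx] := eqVneq y x.
  by rewrite !subrr mulr0 subr0 normr0 mulr0.
have yx0 : y - x != 0 by rewrite subr_eq0.
have : `|F' x - (F y - F x) / (y - x)| <= e.
  by apply: hd => //; rewrite /= in_itv.
rewrite distrC => h.
have -> : F y - F x - F' x * (y - x) = ((F y - F x) / (y - x) - F' x) * (y - x).
  by field.
by rewrite normrM ler_wpM2r.
Qed.

Lemma deriv01_cont (F F' : R -> R) : deriv01 F F' -> {within `[0, 1], continuous F}.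
Proof.
move=> dF; apply/subspace_continuousP => x; rewrite /= in_itv /= => x01.
have [d d0 hd] := deriv01_eps dF x01 ltr01.
apply/cvgrPdist_le => e e0; rewrite near_withinE.
have K0 : 0 < `|F' x| + 1 by rewrite ltr_wpDl.
have m0 : 0 < Num.min d (e / (`|F' x| + 1)) by rewrite lt_min d0 divr_gt0.
apply: filterS (nbhsx_ballx x _ m0) => y; rewrite /ball /= lt_min => /andP[xd xe].
rewrite in_itv /= /from_subspace => y01; rewrite distrC.
have -> : F y - F x = (F y - F x - F' x * (y - x)) + F' x * (y - x) by ring.
rewrite (le_trans (ler_normD _ _))// normrM.
move: xe; rewrite ltr_pdivlMr// => /ltW; apply: le_trans.
rewrite [leRHS]mulrDr mulr1 [leRHS]addrC (distrC x y) lerD//; last by rewrite mulrC.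
by have := hd y y01 xd; rewrite mul1r.
Qed.

End deriv01_theory.

Section krein_feller_integral_form.
Context (R : realType) (nu : kf_measure R) (b : bcond).
Implicit Types f g : Cspace nu b.

(** Integral form of the relation g = f'' with respect to nu; in the Dirichlet
    case the boundary conditions are part of the definition of the space. *)
Definition kfrel f g := exists a c : R,
  (forall x, 0 <= x <= 1 -> hat f x = a + c * x + primitive2 nu (hat g) x) /\
  (b = Neumann -> c = 0 /\ mean nu (hat g) = 0).

Lemma bmeas_hat f : bmeas (hat f).
Proof. exact/bmeas_cont/hat_cont. Qed.
Hint Resolve bmeas_hat : core.

Lemma Rintegral_primitive g x : 0 <= x <= 1 ->
  \int[nu]_(y in `[0, x]) (Cval g : R -> R) y = primitive nu (hat g) x.
Proof.
move=> /andP[x0 x1].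
have gh := (hat_rep g).2.
have mx : measurable (`[0, x] : set (measurableTypeR R)) by exact: itvR_measurable.
have -> : \int[nu]_(y in `[0, x]) (Cval g : R -> R) y =
    \int[nu]_(y in `[0, x]) hat g y.
  rewrite /Rintegral; congr fine; apply: ae_eq_integral => //.
  - apply/measurable_EFinP; apply: measurable_funTS.
    by have := L2_Lfun (Cval g) => /sub_Lfun_mfun; rewrite inE.
  - by apply/measurable_EFinP; apply: measurable_funTS; exact: (bmeas_hat g).1.
  by apply: negligibleS gh => y /= ny e; apply: ny => _; rewrite (e I).
have -> : `[0, x]%classic = `[0, 1]%classic `&` `]-oo, x]%classic :> set R.
  apply/seteqP; split => y /=; rewrite !in_itv /=.
    by move=> /andP[-> yx]; rewrite (le_trans yx).
  by move=> [/andP[-> _] ->].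
rewrite Rintegral_mkcondr; apply: eq_Rintegral => y _.
by rewrite patchE indicE; case: (_ \in _); rewrite ?mul1r ?mul0r.
Qed.

(** F - primitive2 g has the constant derivative F' 0 on [0, 1]; [left_growth] applied to
    it and to its opposite shows that it is affine. *)
Lemma kf_graph_kfrel f g : kf_graph b (Cval f) (Cval g) -> kfrel f g.
Proof.
move=> [F [F' [fF [dF cF' eF'] bc]]].
have F'E x : 0 <= x <= 1 -> F' x = F' 0 + primitive nu (hat g) x.
  by move=> x01; rewrite eF' ?in_itv// Rintegral_primitive.
have [M hM] := (bmeas_hat g).2.
have M0 : 0 <= M by apply: le_trans (hM 0 _) => //; rewrite lexx ler01.
have M1 : 0 < M + 1 by rewrite ltr_wpDl.
pose P := primitive2 nu (hat g).
pose N x := F (clamp x) - P (clamp x).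
have cN : continuous N.
  move=> x; apply: cvgB; first exact: (clamp_comp_cont (deriv01_cont dF)).
  apply: (@continuous_comp _ _ _ (@clamp R) P); first exact: clamp_cont.
  exact: primitive2_cont.
have dN t e : 0 < t <= 1 -> 0 < e ->
    \forall h \near 0^'+, `|N t - N (t - h) - h * F' 0| <= h * e.
  move=> /andP[t0 t1] e0; have t01 : 0 <= t <= 1 by rewrite ltW.
  have e2 : 0 < e / 2 by rewrite divr_gt0.
  have [d d0 hd] := deriv01_eps dF t01 e2.
  have [r r0 hr] := small_mass nu t (divr_gt0 e2 M1).
  near=> h.
  have h0 : 0 < h by near: h; exact: nbhs_right_gt.
  have ht : h < t by near: h; exact: nbhs_right_lt.
  have hhd : h < d by near: h; exact: nbhs_right_lt.
  have hhr : h < r by near: h; exact: nbhs_right_lt.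
  have th01 : 0 <= t - h <= 1.
    by rewrite subr_ge0 (ltW ht) lerBlDr (le_trans t1)// lerDl ltW.
  have thE : t - h - t = - h by ring.
  have htE : t - (t - h) = h by ring.
  have := hd (t - h) th01; rewrite htE (gtr0_norm h0) => /(_ hhd).
  rewrite thE normrN (gtr0_norm h0) => est1.
  have := primitive2_taylor nu (t - h) t (bmeas_hat g) hM; rewrite -/P.
  rewrite thE normrN (gtr0_norm h0) => est2.
  have mass : fine (nu `[Num.min (t - h) t, Num.max (t - h) t]%classic) <= e / 2 / (M + 1).
    apply: le_trans hr; apply: fine_le.
    - by rewrite fin_num_measure//; exact: itvR_measurable.
    - by rewrite fin_num_measure//; exact: itvR_measurable.
    apply: le_measure; rewrite ?inE; [exact: itvR_measurable..|].
    move=> y; rewrite /= !in_itv /= => /andP[y1 y2].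
    rewrite min_l in y1; last by rewrite gerBl ltW.
    rewrite max_r in y2; last by rewrite gerBl ltW.
    by rewrite (le_trans _ y1) ?(le_trans y2)// ?lerDl ?ltW// ltrD2l ltrN2.
  have est3 : `|P (t - h) - P t - - h * primitive nu (hat g) t| <= h * (e / 2).
    rewrite (le_trans est2)// -mulrA ler_pM2l//.
    rewrite (@le_trans _ _ ((M + 1) * (e / 2 / (M + 1))))//.
      by rewrite ler_pM// ?lerDl// fine_ge0.
    by rewrite mulrC divfK// gt_eqF.
  rewrite /N !clampK//.
  have -> : F t - P t - (F (t - h) - P (t - h)) - h * F' 0 =
     (P (t - h) - P t - - h * primitive nu (hat g) t) -
     (F (t - h) - F t - F' t * - h) by rewrite (F'E t)//; ring.
  rewrite (le_trans (ler_normB _ _))//.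
  have -> : h * e = h * (e / 2) + e / 2 * h by field.
  exact: lerD.
have FE x : 0 <= x <= 1 -> F x = F 0 + F' 0 * x + P x.
  move=> x01; have /andP[x0 x1] := x01.
  have le1 : N x <= N 0 + x * F' 0.
    apply: left_growth => // t e /andP[t0 tx] e0.
    have t01 : 0 < t <= 1 by rewrite t0 (le_trans tx).
    apply: filterS (dN t e t01 e0) => h; rewrite mulrDr ler_norml; lra.
  have le2 : - N x <= - N 0 + x * - F' 0.
    apply: (@left_growth _ (fun y => - N y)) => //.
      by move=> y; apply: cvgN; exact: cN.
    move=> t e /andP[t0 tx] e0.
    have t01 : 0 < t <= 1 by rewrite t0 (le_trans tx).
    apply: filterS (dN t e t01 e0) => h; rewrite mulrDr ler_norml; lra.
  have N0 : N 0 = F 0 by rewrite /N clampK ?lexx ?ler01// /P primitive20 subr0.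
  have Nx : N x = F x - P x by rewrite /N clampK.
  move: le1 le2; rewrite N0 Nx; clear; lra.
exists (F 0), (F' 0); split; last first.
  move=> bN; have [F00 F10] : F' 0 = 0 /\ F' 1 = 0 by move: bc; rewrite bN.
  split => //.
  by have := F'E 1; rewrite F10 F00 add0r primitive1 lexx ler01 => <-.
pose h x := F' 0 * x + (F 0 + P x).
have hE x : F 0 + F' 0 * x + P x = h x by rewrite /h; ring.
move=> x x01; rewrite hE; apply: hat_uniq => //; last first.
  apply: gap_affineD; first by move=> i _; exists 0, 1 => y _; ring.
  move=> i isub; have [c [d cd]] := primitive2_gap (bmeas_hat g) isub.
  by exists (F 0 + c), d => y yi; rewrite /P cd//; ring.
split.
  apply: continuous_subspaceT => y; apply: cvgD.
    by apply: cvgM; [exact: cvg_cst|exact: cvg_id].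
  by apply: cvgD; [exact: cvg_cst|exact: primitive2_cont].
apply: ae_eq_trans fF _; apply: ae_supp => y sy.
by rewrite FE ?hE//; exact: supp_itv sy.
Unshelve. all: by end_near. Qed.

End krein_feller_integral_form.

(** * The inverse of the Krein-Feller operator *)

(** The projection onto the kernel of the Krein-Feller operator along its range:
    the mean for Neumann conditions, 0 for Dirichlet conditions. *)
Definition proj (R : realType) (nu : kf_measure R) (b : bcond) (h : R -> R) : R :=
  if b is Neumann then mean nu h else 0.

(** The solution of p'' = h - proj h with respect to nu, under the boundary
    conditions, normalised by proj p = 0. *)
Definition green (R : realType) (nu : kf_measure R) (b : bcond) (h : R -> R)
    (x : R) : R :=
  let p := primitive2 nu (fun y => h y - proj nu b h) in
  if b is Neumann then p x - mean nu p else p x - x * p 1.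

(** The Green operator on classes. *)
HB.lock Definition green_op (R : realType) (nu : kf_measure R) (b : bcond)
    (g : Cspace nu b) : Cspace nu b := Cmk nu b (green nu b (hat g)).

(** The class of the constant [proj g]. *)
HB.lock Definition proj_op (R : realType) (nu : kf_measure R) (b : bcond)
    (g : Cspace nu b) : Cspace nu b := Cmk nu b (fun=> proj nu b (hat g)).

Section green_operator.
Context (R : realType) (nu : kf_measure R) (b : bcond).
Implicit Types f g : Cspace nu b.
Hint Resolve bmeas_hat : core.

Local Notation proj := (proj nu b).
Local Notation green := (green nu b).
Local Notation green_op := (@green_op R nu b).
Local Notation proj_op := (@proj_op R nu b).

Lemma proj_lin a (g h : R -> R) : bmeas g -> bmeas h ->
  proj (fun y => a * g y + h y) = a * proj g + proj h.
Proof.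
by rewrite /proj; case: b => bg bh; [exact: mean_lin|rewrite mulr0 addr0].
Qed.

Lemma eq_proj (g h : R -> R) : (forall y, 0 <= y <= 1 -> g y = h y) -> proj g = proj h.
Proof. by rewrite /proj => gh; case: b => //; exact: eq_mean. Qed.

Lemma proj_bound h M : bmeas h -> (forall y, 0 <= y <= 1 -> `|h y| <= M) ->
  `|proj h| <= M.
Proof.
move=> bh hM; rewrite /proj; case: b; first exact: mean_bound.
by rewrite normr0 (le_trans (normr_ge0 (h 0)))// hM// lexx ler01.
Qed.

Lemma bmeas_centered h : bmeas h -> bmeas (fun y => h y - proj h).
Proof. by move=> bh; apply: bmeasB => //; exact: bmeas_cst. Qed.

Lemma bmeas_primitive2 h : bmeas h -> bmeas (primitive2 nu h).
Proof. by move=> bh; apply: bmeas_cont; exact: primitive2_cont. Qed.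

Lemma eq_green (g h : R -> R) x : (forall y, 0 <= y <= 1 -> g y = h y) ->
  green g x = green h x.
Proof.
move=> gh; rewrite /green.
have -> : primitive2 nu (fun y => g y - proj g) = primitive2 nu (fun y => h y - proj h).
  by apply/funext => w; apply: eq_primitive2 => y y01; rewrite gh// (eq_proj gh).
by [].
Qed.

Lemma green_lin a (g h : R -> R) x : bmeas g -> bmeas h ->
  green (fun y => a * g y + h y) x = a * green g x + green h x.
Proof.
move=> bg bh; rewrite /green.
set p := primitive2 _ _; set q := primitive2 nu (fun y => g y - _).
set r := primitive2 nu (fun y => h y - _).
have bq : bmeas q by exact/bmeas_primitive2/bmeas_centered.
have br : bmeas r by exact/bmeas_primitive2/bmeas_centered.
have -> : p = (fun w => a * q w + r w).
  apply/funext => w; rewrite /p /q /r -primitive2_lin//; try exact: bmeas_centered.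
  by apply: eq_primitive2 => y _; rewrite proj_lin//; ring.
clearbody p q r; case: b; last by ring.
by rewrite mean_lin//; ring.
Qed.

Lemma green_cont h : bmeas h -> continuous (green h).
Proof.
move=> bh; have cp := @primitive2_cont _ nu _ (bmeas_centered bh).
rewrite /green; move: (primitive2 nu _) cp => p cp.
case: b => x; apply: cvgB; [exact: cp|exact: cvg_cst|exact: cp|].
by apply: cvgM; [exact: cvg_id|exact: cvg_cst].
Qed.

Lemma green_gap h : bmeas h -> gap_affine nu (green h).
Proof.
move=> bh i isub; rewrite /green.
have [c [d cd]] := primitive2_gap (bmeas_centered bh) isub.
move: (primitive2 nu _) cd => p cd.
case: b; first by exists (c - mean nu p), d => y yi; rewrite cd// addrAC.
by exists c, (d - p 1) => y yi; rewrite cd//; ring.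
Qed.

Lemma green_bvals h : bvals b (green h).
Proof.
by rewrite /green; case: b => //=; rewrite primitive20 mul0r mul1r !subrr.
Qed.

Lemma proj_bvals h : bvals b (fun=> proj h).
Proof. by rewrite /proj; case: b. Qed.

Lemma green_bound h M x : bmeas h -> 0 <= x <= 1 ->
  (forall y, 0 <= y <= 1 -> `|h y| <= M) -> `|green h x| <= 4 * M.
Proof.
move=> bh x01 hM; have bc := bmeas_centered bh.
have cM y : 0 <= y <= 1 -> `|h y - proj h| <= M + M.
  by move=> y01; rewrite (le_trans (ler_normB _ _))// lerD ?hM// proj_bound.
have pM y : 0 <= y <= 1 -> `|primitive2 nu (fun y => h y - proj h) y| <= M + M.
  by move=> y01; exact: primitive2_bound.
have -> : 4 * M = (M + M) + (M + M) by ring.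
have /andP[x0 x1] := x01.
have bp := bmeas_primitive2 bc.
rewrite /green; move: (primitive2 nu _) pM bp => p pM bp.
case: b; rewrite (le_trans (ler_normB _ _))// lerD ?pM//.
  exact: mean_bound.
rewrite normrM (ger0_norm x0).
have p1 := pM 1; rewrite ler01 lexx in p1.
by rewrite (le_trans _ (p1 isT))// ler_piMl.
Qed.

Lemma proj_green h : bmeas h -> proj (green h) = 0.
Proof.
move=> bh; rewrite /green; have bp := bmeas_primitive2 (bmeas_centered bh).
move: (primitive2 nu _) bp => p bp; rewrite /proj; case: b => //.
by rewrite meanB ?mean_cst ?subrr//; exact: bmeas_cst.
Qed.

Lemma hat_green_op g x : 0 <= x <= 1 -> hat (green_op g) x = green (hat g) x.
Proof.
rewrite green_op.unlock; apply: hat_Cmk; [|exact: green_bvals|exact: green_gap].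
exact/continuous_subspaceT/green_cont.
Qed.

Lemma hat_proj_op g x : 0 <= x <= 1 -> hat (proj_op g) x = proj (hat g).
Proof.
rewrite proj_op.unlock; apply: hat_Cmk.
- by apply/continuous_subspaceT => ?; exact: cvg_cst.
- exact: proj_bvals.
by move=> i _; exists (proj (hat g)), 0 => y _; rewrite mul0r addr0.
Qed.

Lemma hatB f g x : hat (f - g) x = hat f x - hat g x.
Proof. by rewrite addrC -scaleN1r hat_lin mulN1r addrC. Qed.

Lemma green_op_bl : bounded_linear 4 green_op.
Proof.
split=> [a f g|f].
  apply: hat_inj => x /supp_itv x01.
  rewrite [RHS](hat_lin a (green_op f) (green_op g)) [LHS](hat_green_op _ x01).
  rewrite [in RHS](hat_green_op f x01) [in RHS](hat_green_op g x01).
  rewrite -[RHS](green_lin a x (bmeas_hat f) (bmeas_hat g)).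
  by apply: eq_green => y _; rewrite hat_lin.
apply: norm_hat_le => x /supp_itv x01; rewrite (hat_green_op f x01).
apply: (green_bound (bmeas_hat f) x01) => y _; exact: hat_le.
Qed.

Lemma proj_op_bl : bounded_linear 1 proj_op.
Proof.
split=> [a f g|f].
  apply: hat_inj => x /supp_itv x01.
  rewrite [RHS](hat_lin a (proj_op f) (proj_op g)) [LHS](hat_proj_op _ x01).
  rewrite [in RHS](hat_proj_op f x01) [in RHS](hat_proj_op g x01).
  rewrite -[RHS](proj_lin a (bmeas_hat f) (bmeas_hat g)).
  by apply: eq_proj => y _; rewrite hat_lin.
apply: norm_hat_le => x /supp_itv x01; rewrite (hat_proj_op f x01) mul1r.
by apply: (proj_bound (bmeas_hat f)) => y _; exact: hat_le.
Qed.

Lemma kfrelB f g f' g' : kfrel f g -> kfrel f' g' -> kfrel (f - f') (g - g').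
Proof.
move=> [a [c [fE bc]]] [a' [c' [fE' bc']]]; exists (a - a'), (c - c'); split.
  move=> x x01; rewrite hatB fE// fE'//.
  rewrite (@eq_primitive2 _ nu (hat (g - g')) (fun y => (-1) * hat g' y + hat g y)).
    by rewrite primitive2_lin//; ring.
  by move=> y _; rewrite hatB /= mulN1r addrC.
move=> bN; have [-> g0] := bc bN; have [-> g0'] := bc' bN.
split; first by rewrite subrr.
rewrite (eq_mean nu (h := fun y => (-1) * hat g' y + hat g y)).
  by rewrite mean_lin// g0 g0' mulr0 addr0.
by move=> y _; rewrite hatB /= mulN1r addrC.
Qed.

End green_operator.

(** * Dissipativity *)

Section pseudo_inverse_instance.
Context (R : realType) (nu : kf_measure R) (b : bcond).
Implicit Types f g : Cspace nu b.

Lemma kfrel_green_op g : kfrel (green_op g) (g - proj_op g).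
Proof.
have cE y : 0 <= y <= 1 -> hat (g - proj_op g) y = hat g y - proj nu b (hat g).
  by move=> y01; rewrite hatB hat_proj_op.
pose p := primitive2 nu (fun y => hat g y - proj nu b (hat g)).
have GE x : 0 <= x <= 1 -> hat (green_op g) x = green nu b (hat g) x by exact: hat_green_op.
have PE x : primitive2 nu (hat (g - proj_op g)) x = p x by exact: eq_primitive2.
have ME : b = Neumann -> mean nu (hat (g - proj_op g)) = 0.
  move=> bN; rewrite (eq_mean nu cE) meanB ?mean_cst; last 2 first.
  - exact: bmeas_hat.
  - exact: bmeas_cst.
  by move: (hat g) => h; rewrite /proj bN subrr.
exists (if b is Neumann then - mean nu p else 0), (if b is Neumann then 0 else - p 1).
split=> [x x01|bN]; last by split; [clear -bN; clearbody p; rewrite bN|exact: ME].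
rewrite (GE x x01) PE /green -/p; clearbody p; clear.
by case: b; ring.
Qed.

Lemma hat0 x : hat (0 : Cspace nu b) x = 0.
Proof. by rewrite -(subrr (0 : Cspace nu b)) hatB subrr. Qed.

Lemma hatN f x : hat (- f) x = - hat f x.
Proof. by rewrite -[- f]sub0r hatB hat0 sub0r. Qed.

Lemma kfrel_proj_op g : kfrel (proj_op g) 0.
Proof.
exists (proj nu b (hat g)), 0; split.
  move=> x x01; rewrite hat_proj_op// mul0r addr0 -[LHS]addr0; congr (_ + _).
  rewrite -[LHS](mean_cst nu) /primitive2; apply: eq_mean => y _.
  by rewrite hat0 mulr0.
move=> _; split => //.
by rewrite -[RHS](mean_cst nu); apply: eq_mean => y _; exact: hat0.
Qed.

Lemma proj_kfrel f g : kfrel f g -> proj nu b (hat g) = 0.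
Proof.
move=> [a [c [_ bc]]]; rewrite /proj; move: (hat g) bc => h.
by case: b => // /(_ erefl)[].
Qed.

Lemma green_op_kfrel f g : kfrel f g -> green_op g = f - proj_op f.
Proof.
move=> fg; have g0 := proj_kfrel fg; have [a [c [fE bc]]] := fg.
apply: hat_inj => x /supp_itv x01; rewrite hatB (hat_green_op g x01) (hat_proj_op f x01).
have fb := hat_bvals f.
have := bmeas_hat f.
move: (hat f) (hat g) g0 fE bc fb => h k {fg f g} k0 hE bc hb bh.
have pE : primitive2 nu (fun y => k y - proj nu b k) = primitive2 nu k.
  by apply/funext => y; apply: eq_primitive2 => z _; rewrite k0 subr0.
rewrite /green pE; move: (primitive2 nu k) (primitive20 nu k) hE => p p0 hE.
rewrite /proj; case: b bc hb => [/(_ erefl)[c0 _] _|_ [h0 h1]].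
  have {}pE y : 0 <= y <= 1 -> p y = h y - a.
    by move=> y01; rewrite hE// c0; ring.
  rewrite pE// (eq_mean nu pE) meanB// ?mean_cst; last exact: bmeas_cst.
  by ring.
have := hE 0; rewrite lexx ler01 h0 p0 mulr0 !addr0 => /(_ isT) a0.
have := hE 1; rewrite lexx ler01 h1 -a0 add0r mulr1 => /(_ isT) c1.
have {}c1 : c = - p 1 by apply/eqP; rewrite -addr_eq0 -c1.
by rewrite hE// -a0 c1; ring.
Qed.

(** The integral form E of f makes sense on the whole line, and a positive maximum s of
    f on [0, 1] is a local maximum of E there: outside [0, 1] E is constant under
    Neumann conditions, while s is interior under Dirichlet conditions. *)
Lemma kfrel_local_max f g s (E := fun a c w => a + c * w + primitive2 nu (hat g) w) a c :
  (forall x, 0 <= x <= 1 -> hat f x = E a c x) ->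
  (b = Neumann -> c = 0 /\ mean nu (hat g) = 0) ->
  0 <= s <= 1 -> (forall x, 0 <= x <= 1 -> hat f x <= hat f s) -> 0 < hat f s ->
  exists2 r, 0 < r & forall w, `|s - w| <= r -> E a c w <= E a c s.
Proof.
rewrite /E; have fb := hat_bvals f; have := bmeas_hat g.
move: (hat f) (hat g) fb => h k hb bk hE bc s01 smax s0.
have smax' w : 0 <= w <= 1 -> a + c * w + primitive2 nu k w <= a + c * s + primitive2 nu k s.
  by move=> w01; rewrite -!hE// smax.
case: b bc hb => [/(_ erefl)[c0 k0] _|_ [h0 h1]].
  exists 1 => // w _.
  have [w0|/ltW w0] := leP w 0.
    have := smax' 0; rewrite lexx ler01 => /(_ isT).
    by rewrite c0 !mul0r (primitive2_le0 nu k w0) primitive20.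
  have [w1|/ltW w1] := leP w 1; first by rewrite smax'// w0.
  have := smax' 1; rewrite lexx ler01 => /(_ isT).
  by rewrite c0 !mul0r (primitive2_ge1 nu bk w1) k0 mulr0 !addr0.
have /andP[s0' s1'] := s01.
have s00 : 0 < s.
  by rewrite lt_neqAle s0' andbT; apply/eqP => s00; move: s0; rewrite -s00 h0 ltxx.
have s11 : s < 1.
  by rewrite lt_neqAle s1' andbT; apply/eqP => s11; move: s0; rewrite s11 h1 ltxx.
exists (Num.min s (1 - s)); first by rewrite lt_min s00 subr_gt0.
move=> w; rewrite le_min => /andP[w1 w2]; apply: smax'; apply/andP; split.
  by have := le_trans (ler_norm _) w1; rewrite gerBl.
by have := ler_norm (- (s - w)); rewrite normrN => /le_trans /(_ w2); clear; lra.
Qed.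

(** The maximum principle: at a positive maximum s of y in the support z is not
    positive, as y would otherwise be strictly convex near s. *)
Lemma kfrel_max_le (y z : Cspace nu b) (h : R) : kfrel y z -> 0 <= h ->
  forall x, 0 <= x <= 1 -> hat y x <= `|y - h *: z|.
Proof.
move=> [a [c [yE bc]]] h0.
have [x1 x101 hx1] := EVT_max ler01 (@hat_within _ _ _ y).
have x101' : 0 <= x1 <= 1 by move: x101; rewrite in_itv.
have [s ss x1s] := gap_affine_max (@hat_within _ _ _ y) (@hat_gap _ _ _ y) x101'.
have s01 := supp_itv ss.
have smax x : 0 <= x <= 1 -> hat y x <= hat y s.
  by move=> x01; rewrite (le_trans _ x1s)// hx1// in_itv.
move=> x x01; rewrite (le_trans (smax _ x01))//.
have [ys|ys] := leP (hat y s) 0; first exact: le_trans ys _.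
have [zs|zs] := leP (hat z s) 0.
  have hE : hat (y - h *: z) s = hat y s - h * hat z s.
    by rewrite -scaleNr addrC hat_lin mulNr addrC.
  apply: le_trans (le_trans (ler_norm _) (hat_le (y - h *: z) s)).
  by rewrite hE lerDl oppr_ge0 mulr_ge0_le0.
exfalso.
have [r r0 Er] := kfrel_local_max yE bc s01 smax ys.
have z2 : 0 < hat z s / 2 by rewrite divr_gt0.
have : \forall w \near s, `|hat z s - hat z w| < hat z s / 2.
  by move: (@hat_cont _ _ _ z s) => /cvgrPdist_lt; apply.
move=> /nbhs_ballP[d /= d0 hd].
pose m := Num.min r d; have m0 : 0 < m by rewrite lt_min r0.
have zlow w : 0 <= w <= 1 -> `|s - w| < m -> hat z s / 2 <= hat z w.
  move=> _ sw; have /hd/= : `|s - w| < d by rewrite (lt_le_trans sw)// ge_min lexx orbT.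
  by rewrite ltr_norml => /andP[_]; clear; lra.
have := primitive2_convex (bmeas_hat z) ss m0 z2 zlow.
have E1 := Er (s + m); have E2 := Er (s - m).
have sm1 : s - (s + m) = - m by ring.
have sm2 : s - (s - m) = m by ring.
rewrite sm1 normrN (gtr0_norm m0) ge_min lexx in E1.
rewrite sm2 (gtr0_norm m0) ge_min lexx in E2.
move: (E1 isT) (E2 isT); clear; move: (primitive2 nu (hat z)) => p; lra.
Qed.

Lemma kfrel_dissipative : dissipative (@kfrel R nu b).
Proof.
move=> y z h yz h0; apply: norm_hat_le => x /supp_itv x01.
rewrite ler_norml (kfrel_max_le yz h0 x01) andbT lerNl -hatN.
have k00 : kfrel (0 : Cspace nu b) 0.
  by have := kfrelB (kfrel_proj_op y) (kfrel_proj_op y); rewrite !subrr.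
have := kfrelB k00 yz; rewrite !sub0r => yz'.
have E : `|- y - h *: - z| = `|y - h *: z|.
  by rewrite scalerN opprK -[RHS]normrN opprB addrC.
by rewrite -E; exact: kfrel_max_le yz' h0 x x01.
Qed.

Lemma kf_pseudo_inverse : pseudo_inverse 4 (@kfrel R nu b) (@green_op R nu b) (@proj_op R nu b).
Proof.
split.
- exact: green_op_bl.
- exact: proj_op_bl.
- by move=> *; exact: kfrelB.
- exact: kfrel_dissipative.
- exact: green_op_kfrel.
- move=> x y xy; apply: hat_inj => z /supp_itv z01.
  by rewrite (hat_proj_op y z01) hat0 (proj_kfrel xy).
- exact: kfrel_green_op.
- move=> y; apply: hat_inj => z /supp_itv z01.
  rewrite (hat_proj_op _ z01) hat0 (eq_proj nu b (h := green nu b (hat y))).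
    exact/proj_green/bmeas_hat.
  by move=> w w01; exact: hat_green_op.
- exact: kfrel_proj_op.
Qed.

End pseudo_inverse_instance.

(** * Dependence on the measure *)

Section embedding.
Context (R : realType) (b : bcond) (mu nu : kf_measure R).
Hypothesis hsupp : supp mu `<=` supp nu.

Lemma gap_affineS (h : R -> R) : gap_affine mu h -> gap_affine nu h.
Proof.
move=> gh i isub; apply: gh => x /isub[x01 nx]; split => // sx.
exact/nx/hsupp.
Qed.

(** The embedding preserves gap-affine representatives, as each gap of the larger
    support lies in a gap of the smaller one. *)
Lemma hat_embedC (f : Cspace mu b) x : hat (embedC nu f) x = hat f x.
Proof.
have cr : cont_rep (Cval (Cmk nu b (hat f))) (hat f).
  by apply: Cmk_rep; [exact: hat_within|exact: hat_bvals].
rewrite /embedC; case: xgetP => [g _ [h [fh gh gE]]|noC]; last first.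
  exfalso; apply: (noC (Cmk nu b (hat f))); exists (hat f); split.
  - exact: hat_rep.
  - exact: hat_gap.
  - exact: cr.2.
rewrite -[RHS]hat_clamp; apply: hat_eq; last exact/gap_affineS/hat_gap.
split; first exact: hat_within.
apply: ae_eq_trans gE _; apply: ae_supp => y /supp_itv y01.
by rewrite (hat_uniq fh gh).
Qed.

Lemma embedC_bl : bounded_linear 1 (@embedC R b mu nu).
Proof.
split=> [a f g|f].
  apply: hat_inj => x _.
  rewrite [LHS]hat_embedC [LHS]hat_lin [RHS]hat_lin.
  by congr (a * _ + _); rewrite hat_embedC.
by apply: norm_hat_le => x _; rewrite mul1r hat_embedC; exact: hat_le.
Qed.

End embedding.

Section convergence.
Context (R : realType) (b : bcond) (mu : kf_measure R) (mun : nat -> kf_measure R).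
Hypothesis hsupp : forall n, supp mu `<=` supp (mun n).
Hypothesis hweak : weak_cvg mun mu.

Lemma mean_cvg (h : R -> R) (e : R) : continuous h -> 0 < e ->
  \forall n \near \oo, `|mean (mun n) h - mean mu h| <= e.
Proof.
move=> ch e0; have := hweak (continuous_subspaceT ch).
move=> /cvgrPdist_le /(_ e e0).
by apply: filterS => n; rewrite distrC.
Qed.

(** Pointwise convergence to 0 of equi-Lipschitz functions is uniform on [0, 1]. *)
Lemma lip_unif (psi : nat -> R -> R) (L : R) :
  (forall n x y, `|psi n x - psi n y| <= `|x - y| * L) ->
  (forall x e, 0 < e -> \forall n \near \oo, `|psi n x| <= e) ->
  forall e, 0 < e ->
    \forall n \near \oo, forall x, 0 <= x <= 1 -> `|psi n x| <= e.
Proof.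
move=> psiL psi0 e e0; have e2 : 0 < e / 2 by rewrite divr_gt0.
have L1 : 0 < `|L| + 1 by rewrite ltr_wpDl.
have cK := (compact_near_coveringP _).1 (@segment_compact R 0 1).
have h := cK nat \oo (fun n t => `|psi n t| <= e) _.
have : \forall n \near \oo, `[0, 1] `<=` (fun t => `|psi n t| <= e).
  apply: h => t _; near=> s n => /=.
  have -> : psi n s = psi n t - (psi n t - psi n s) by rewrite opprB addrC subrK.
  rewrite (le_trans (ler_normB _ _))// (splitr e) lerD//.
    by near: n; exact: psi0.
  rewrite (le_trans (psiL _ _ _))//.
  have : ball t (e / 2 / (`|L| + 1)) s.
    by near: s; apply: nbhsx_ballx; rewrite divr_gt0.
  rewrite /ball /= ltr_pdivlMr// => /ltW; apply: le_trans.
  by rewrite ler_wpM2l// (le_trans (ler_norm L))// lerDl.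
by apply: filterS => n hn t tT; apply: hn; rewrite /= in_itv.
Unshelve. all: by end_near. Qed.

Lemma primitive2_cvg (h : R -> R) (e : R) : continuous h -> 0 < e ->
  \forall n \near \oo, forall x, 0 <= x <= 1 ->
    `|primitive2 (mun n) h x - primitive2 mu h x| <= e.
Proof.
move=> ch e0; have [M hM] := (bmeas_cont ch).2.
apply: (@lip_unif (fun n x => primitive2 (mun n) h x - primitive2 mu h x) (2 * M)) => //.
  move=> n x y; rewrite subrACA (le_trans (ler_normB _ _))//.
  by rewrite mulr_natl mulr2n mulrDr lerD// primitive2_lip//; exact: bmeas_cont.
move=> x d d0; apply: mean_cvg => // y.
by apply: cvgM; [exact: kernel_cont|exact: ch].
Qed.

Lemma proj_cvg (h : R -> R) (e : R) : continuous h -> 0 < e ->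
  \forall n \near \oo, `|proj (mun n) b h - proj mu b h| <= e.
Proof.
rewrite /proj => ch e0; case: b; first exact: mean_cvg.
by near=> n; rewrite subrr normr0 ltW.
Unshelve. all: by end_near. Qed.

(** Weak convergence of the measures gives uniform convergence of the potentials,
    since these are equi-Lipschitz. *)
Lemma green_cvg (h : R -> R) (e : R) : continuous h -> 0 < e ->
  \forall n \near \oo, forall x, 0 <= x <= 1 ->
    `|green (mun n) b h x - green mu b h x| <= e.
Proof.
move=> ch e0; have e6 : 0 < e / 6 by rewrite divr_gt0.
have bh := bmeas_cont ch.
pose hc y := h y - proj mu b h.
have chc : continuous hc by move=> y; apply: cvgB; [exact: ch|exact: cvg_cst].
pose p := primitive2 mu hc.
have cp : continuous p by apply: primitive2_cont; exact: bmeas_cont.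
have near1 := primitive2_cvg chc e6.
have near2 := proj_cvg ch e6.
have near3 := mean_cvg cp e6.
apply: filterS3 near1 near2 near3 => n h1 h2 h3.
pose pn := primitive2 (mun n) (fun y => h y - proj (mun n) b h).
have bpn : bmeas pn by apply: bmeas_primitive2; exact: bmeas_centered.
have bp : bmeas p by exact: bmeas_cont.
have pnp x : 0 <= x <= 1 -> `|pn x - p x| <= e / 6 + e / 6.
  move=> x01; pose d := proj mu b h - proj (mun n) b h.
  have -> : pn x = primitive2 (mun n) (fun=> d) x + primitive2 (mun n) hc x.
    rewrite -primitive2D; [|exact: bmeas_cst|exact: bmeas_cont].
    by apply: eq_primitive2 => y _; rewrite /d /hc [RHS]addrC subrKA.
  rewrite -addrA (le_trans (ler_normD _ _))// lerD//; last exact: h1.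
  by apply: primitive2_bound => //; [exact: bmeas_cst|move=> y _; rewrite distrC].
move=> x x01; rewrite /green -/pn -/hc -/p.
move: pn p bpn bp pnp h3 {cp} => pn p bpn bp pnp h3.
have := pnp 1; rewrite lexx ler01 => /(_ isT) p1.
have xe := pnp x x01.
have /andP[x0 x1] := x01.
case: b.
  have -> : pn x - mean (mun n) pn - (p x - mean mu p) =
     (pn x - p x) - (mean (mun n) (fun y => pn y - p y) + (mean (mun n) p - mean mu p)).
    by rewrite meanB//; ring.
  rewrite (le_trans (ler_normB _ _))//.
  have m1 : `|mean (mun n) (fun y => pn y - p y)| <= e / 6 + e / 6.
    by apply: mean_bound => //; exact: bmeasB.
  have := ler_normD (mean (mun n) (fun y => pn y - p y)) (mean (mun n) p - mean mu p).
  move: xe m1 h3 e0; clear; lra.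
have -> : pn x - x * pn 1 - (p x - x * p 1) = (pn x - p x) - x * (pn 1 - p 1) by ring.
rewrite (le_trans (ler_normB _ _))// normrM (ger0_norm x0).
have : x * `|pn 1 - p 1| <= `|pn 1 - p 1| by rewrite ler_piMl.
move: xe p1 e0; clear; lra.
Qed.

End convergence.

(** * Convergence of the solutions *)

Section solutions.
Context (R : realType) (nu : kf_measure R) (b : bcond).

Lemma kfC_op_graph (f : Cspace nu b) : kfC_dom nu b f -> kfrel f (kfC_op nu b f).
Proof.
move=> [[g fg] opC]; apply: kf_graph_kfrel.
have -> : Cval (kfC_op nu b f) = kf_op b (Cval f) by exact: insubdK.
by rewrite /kf_op; case: xgetP => [h _ //|/(_ g)].
Qed.

(** A solution, extended to negative times by its initial value. *)
Lemma solution_evolves (f : Cspace nu b) (u : R -> Cspace nu b) :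
  is_solution (kfC_dom nu b) (kfC_op nu b) f u ->
  evolves (@kfrel R nu b) (u \o (fun t => Num.max t 0)).
Proof.
move=> [_ cu du hu]; split; first exact: max0_comp_cont.
move=> t t0; exists (kfC_op nu b (u t)).
  by rewrite /= max_l ?ltW//; exact/kfC_op_graph/du.
have uu := has_deriv_lim (hu t t0).
move=> e e0; have n1 := uu e e0.
have n2 : \forall h \near (0 : R), 0 <= t + h.
  exists t => //= h; rewrite /= sub0r normrN => ht.
  by have := ler_norm (- h); rewrite normrN; move: ht; clear; lra.
by apply: filterS2 n1 n2 => h h1 h2; rewrite /= !max_l// ltW.
Qed.

End solutions.

Theorem theorem5p10 (R : realType) (b : bcond)
    (mu : kf_measure R) (mun : nat -> kf_measure R)
    (hsupp : forall n, supp mu `<=` supp (mun n))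
    (hweak : weak_cvg mun mu)
    (f : Cspace mu b) (u : R -> Cspace mu b)
    (hu : is_solution (kfC_dom mu b) (kfC_op mu b) f u)
    (un : forall n, R -> Cspace (mun n) b)
    (hun : forall n, is_solution (kfC_dom (mun n) b) (kfC_op (mun n) b)
                       (embedC (mun n) f) (un n))
    (T : R) :
  {uniform `[0, T],
     (fun n (t : R) => `|embedC (mun n) (u t) - un n t|) @ \oo
       --> (fun _ : R => 0 : R)}.
Proof.
have cvG (v : Cspace mu b) (e : R) : 0 < e -> \forall n \near \oo,
    `|green_op (embedC (mun n) v) - embedC (mun n) (green_op v)| <= e.
  move=> e0; apply: filterS (green_cvg b hweak (@hat_cont _ _ _ v) e0) => n hn.
  apply: norm_hat_le => x /supp_itv x01; rewrite hatB (hat_embedC (hsupp n)).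
  rewrite (hat_green_op _ x01) (hat_green_op _ x01).
  have -> : hat (embedC (mun n) v) = hat v by apply/funext => y; exact: hat_embedC.
  exact: hn.
have cvq (v : Cspace mu b) (e : R) : 0 < e -> \forall n \near \oo,
    `|embedC (mun n) (proj_op v) - proj_op (embedC (mun n) v)| <= e.
  move=> e0; apply: filterS (proj_cvg b hweak (@hat_cont _ _ _ v) e0) => n hn.
  apply: norm_hat_le => x /supp_itv x01; rewrite hatB (hat_embedC (hsupp n)).
  rewrite (hat_proj_op _ x01) (hat_proj_op _ x01) distrC.
  by have -> : hat (embedC (mun n) v) = hat v by apply/funext => y; exact: hat_embedC.
have init n : (un n \o (fun t => Num.max t 0)) 0 =
    embedC (mun n) ((u \o (fun t => Num.max t 0)) 0).
  by rewrite /= maxxx; have [-> _ _ _] := hu; have [-> _ _ _] := hun n.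
have main := @evolution_convergence R (Cspace mu b) (fun n => Cspace (mun n) b) 4
  (@kfrel R mu b) (@green_op R mu b) (@proj_op R mu b)
  (fun n => @kfrel R (mun n) b) (fun n => @green_op R (mun n) b) (fun n => @proj_op R (mun n) b)
  (fun n => @embedC R b mu (mun n))
  (kf_pseudo_inverse mu b) (fun n => kf_pseudo_inverse (mun n) b)
  (fun n => embedC_bl b (hsupp n)) cvG cvq _ _
  (solution_evolves hu) (fun n => solution_evolves (hun n)) init.
move=> P /uniform_nbhs[E [entE EP]].
move: entE; rewrite -entourage_ballE => -[e /= e0 eE].
have e2 : 0 < e / 2 by rewrite divr_gt0.
apply: filterS (main T _ e2) => n hn; apply: EP => t /=; rewrite in_itv /= => tT.
have /andP[t0 _] := tT.
apply: eE; rewrite /ball /= sub0r normrN normr_id.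
have := hn t tT; rewrite /= max_l// => /le_lt_trans; apply.
by rewrite ltr_pdivrMr// ltr_pMr// ltr1n.
Qed.
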